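(* Let $L=L(\sigma,p_1,p_2,r_1,r_2)$ and $\tilde L=L(\tilde\sigma,\tilde p_1,\tilde p_2,\tilde r_1,\tilde r_2)$ be two boundary value problems of the form described in the context, with $(r_1,r_2)\in\mathcal N$ and $(\tilde r_1,\tilde r_2)\in\mathcal N$, and let $M^1(\lambda)$ and $\tilde M^1(\lambda)$ be their Weyl functions. If $M^1(\lambda)=\tilde M^1(\lambda)$ and $p_j(\lambda)\equiv\tilde p_j(\lambda)$ for $j=1,2$, then $\sigma(x)=\tilde\sigma(x)$ a.e. on $(0,\pi)$ and $r_j(\lambda)\equiv\tilde r_j(\lambda)$ for $j=1,2$.
   Context: For a complex-valued $\sigma\in L_2(0,\pi)$ put $y^{[1]}:=y'-\sigma y$ (quasi-derivative) and $\ell y:=-(y^{[1]})'-\sigma y^{[1]}-\sigma^2y$; this represents $-y''+qy$ with $q=\sigma'\in W_2^{-1}(0,\pi)$ in the sense of distributions. Solutions of $\ell y=\lambda y$ are functions $y$ such that $y$ and $y^{[1]}$ are absolutely continuous on $[0,\pi]$ and the equation holds a.e. on $(0,\pi)$. The problem $L(\sigma,p_1,p_2,r_1,r_2)$ is $$\ell y=\lambda y,\quad x\in(0,\pi),\qquad p_1(\lambda)y^{[1]}(0)-p_2(\lambda)y(0)=0,\qquad r_1(\lambda)y^{[1]}(\pi)+r_2(\lambda)y(\pi)=0,$$ where $p_1,p_2$ are relatively prime polynomials with complex coefficients, and so are $r_1,r_2$; $p_1(\lambda)=\sum_{n=0}^{N_1}a_n\lambda^n$, $p_2(\lambda)=\sum_{n=0}^{N_2}b_n\lambda^n$,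 $N_1,N_2\ge0$; $r_1(\lambda)=\sum_{n=0}^{M_1}c_n\lambda^n$, $r_2(\lambda)=\sum_{n=0}^{M_2}d_n\lambda^n$, $M_1,M_2\ge0$. Normalization: $(r_1,r_2)\in\mathcal N$ means the following. If $\deg r_1\ge\deg r_2$, then $M_1=M_2$ and $c_{M_1}=1$ ($d_{M_2}$ may be zero). If $\deg r_1<\deg r_2$, then $M_1=M_2-1$ and $d_{M_2}=1$ ($c_{M_1}$ may be zero). Let $\psi(x,\lambda)$ be the solution of $\ell y=\lambda y$ with $\psi(\pi,\lambda)=r_1(\lambda)$, $\psi^{[1]}(\pi,\lambda)=-r_2(\lambda)$. The Weyl function of $L$ is the meromorphic function $$M^1(\lambda)=-\frac{\psi(0,\lambda)}{p_1(\lambda)\psi^{[1]}(0,\lambda)-p_2(\lambda)\psi(0,\lambda)}.$$ The objects of $\tilde L$ are defined in the same way, with the quasi-derivative $y'-\tilde\sigma y$.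
   Formalization: The formal statement additionally assumes that p_1 is not the zero polynomial; for p_1 = 0 and p_2 a nonzero constant (Dirichlet condition) M^1 equals 1/p_2 for every σ, r_1, r_2, so the claim as written fails there. *)

(* Defs.v *)
From HB Require Import structures.
From mathcomp Require Import all_boot all_order all_algebra.
From mathcomp Require Import complex.
From mathcomp Require Import all_classical all_reals all_analysis.

Set Implicit Arguments.
Unset Strict Implicit.
Unset Printing Implicit Defensive.

Import Order.TTheory GRing.Theory Num.Theory.
Import numFieldNormedType.Exports.

Local Open Scope classical_set_scope.
Local Open Scope ring_scope.
Local Open Scope complex_scope.

Definition ae_0pi (R : realType) (P : R -> Prop) : Prop :=
  {ae (@lebesgue_measure R), forall x : R, 0 < x < pi -> P x}.

Definition real_L2_0pi (R : realType) (f : R -> R) : Prop :=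
  measurable_fun (`]0, pi[ : set R) f /\
  (@lebesgue_measure R).-integrable `]0, pi[ (fun x => (f x ^+ 2)%:E).

Definition L2_0pi (R : realType) (f : R -> R[i]) : Prop :=
  real_L2_0pi (fun x => complex.Re (f x)) /\
  real_L2_0pi (fun x => complex.Im (f x)).

(* The norm on R[i] takes values in R[i], hence the embedding of e. *)
Definition abs_continuous_0pi (R : realType) (f : R -> R[i]) : Prop :=
  forall e : R, 0 < e -> exists2 d : R, 0 < d &
    forall (n : nat) (a b : 'I_n -> R),
      (forall i, [/\ 0 <= a i, a i < b i & b i <= pi]) ->
      (forall i j, i != j -> b i <= a j \/ b j <= a i) ->
      \sum_(i < n) (b i - a i) < d ->
      \sum_(i < n) `|f (b i) - f (a i)| < e%:C.

(* Derivative of a complex-valued function of a real variable. *)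
Definition has_deriv (R : realType) (f : R -> R[i]) (x : R) (df : R[i]) : Prop :=
  is_derive x (1 : R) (fun t => complex.Re (f t)) (complex.Re df) /\
  is_derive x (1 : R) (fun t => complex.Im (f t)) (complex.Im df).

(* The quasi-derivative y' - sigma y is only defined almost everywhere; yq is
   its absolutely continuous representative, which gives a meaning to the
   values of the quasi-derivative at 0 and pi. *)
Definition is_solution (R : realType) (sigma : R -> R[i]) (lambda : R[i])
    (y yq : R -> R[i]) : Prop :=
  [/\ abs_continuous_0pi y,
      abs_continuous_0pi yq,
      ae_0pi (fun x => exists2 dy, has_deriv y x dy &
                yq x = dy - sigma x * y x) &
      ae_0pi (fun x => exists2 dyq, has_deriv yq x dyq &
                - dyq - sigma x * yq x - sigma x ^+ 2 * y x = lambda * y x)].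

(* The data of L(sigma, p1, p2, r1, r2). *)
Record problem (R : realType) := Problem {
  sigma : R -> R[i];
  p1 : {poly R[i]};
  p2 : {poly R[i]};
  r1 : {poly R[i]};
  r2 : {poly R[i]}
}.

Definition problem_ok (R : realType) (L : problem R) : Prop :=
  [/\ L2_0pi (sigma L), coprimep (p1 L) (p2 L) & coprimep (r1 L) (r2 L)].

(* M1 and M2 are the upper summation limits in the expansions of r1 and r2;
   they are natural numbers, so r1 = 0 with r2 constant is excluded.
   size is the degree plus one, and 0 for the zero polynomial. *)
Definition normalized (R : realType) (r1 r2 : {poly R[i]}) : Prop :=
  exists M1 M2 : nat,
    [/\ (size r1 <= M1.+1)%N, (size r2 <= M2.+1)%N &
        if (size r2 <= size r1)%N then M1 = M2 /\ r1`_M1 = 1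
        else M2 = M1.+1 /\ r2`_M2 = 1].

(* psi x lambda and psiq x lambda stand for psi(x, lambda) and its
   quasi-derivative. *)
Definition is_psi (R : realType) (L : problem R) (psi psiq : R -> R[i] -> R[i]) :
    Prop :=
  forall lambda : R[i],
    [/\ is_solution (sigma L) lambda (psi ^~ lambda) (psiq ^~ lambda),
        psi pi lambda = (r1 L).[lambda] &
        psiq pi lambda = - (r2 L).[lambda]].

Definition weyl_denominator (R : realType) (L : problem R)
    (psi psiq : R -> R[i] -> R[i]) (lambda : R[i]) : R[i] :=
  (p1 L).[lambda] * psiq 0 lambda - (p2 L).[lambda] * psi 0 lambda.

Definition weyl (R : realType) (L : problem R) (psi psiq : R -> R[i] -> R[i])
    (lambda : R[i]) : R[i] :=
  - (psi 0 lambda / weyl_denominator L psi psiq lambda).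

(* Equality of Weyl functions as meromorphic functions. Each denominator is an
   entire function that is not identically zero, so this is equality off a
   discrete set; where a denominator vanishes, the quotient in weyl is only the
   library's convention for division by zero. *)
Definition weyl_eq (R : realType)
    (L : problem R) (psi psiq : R -> R[i] -> R[i])
    (Lt : problem R) (psit psitq : R -> R[i] -> R[i]) : Prop :=
  forall lambda : R[i],
    weyl_denominator L psi psiq lambda != 0 ->
    weyl_denominator Lt psit psitq lambda != 0 ->
    weyl L psi psiq lambda = weyl Lt psit psitq lambda.

(* Main.v *)
Require Import Defs.
From mathcomp Require Import all_boot all_order all_algebra.
From mathcomp Require Import complex.
From mathcomp Require Import all_classical all_reals all_analysis.
From mathcomp Require Import measurable_realfun zify ring lra.

Set Implicit Arguments.
Unset Strict Implicit.
Unset Printing Implicit Defensive.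

Import Order.TTheory GRing.Theory Num.Theory.
Import numFieldNormedType.Exports.
Local Open Scope classical_set_scope.
Local Open Scope ring_scope.
Local Open Scope complex_scope.

(** The two problems are compared through their fundamental solutions. Let
    [c, s] solve the first equation with [c = 1, c^[1] = 0] and
    [s = 0, s^[1] = 1] at [0], let [ct, st] do the same for the second one, and
    put [D(x, l) = s ct - c st], the upper right entry of the matrix that carries
    the second fundamental system to the first. If [D(x, l) = 0] for all [x] at
    a single [l], the other entries of that matrix are forced to be those of the
    identity and [sigma = sigmat] a.e. ([potential_unique]).

    To see that [D(x, 0) = 0], fix [x]. The Picard iterates of [c], [s] are
    polynomials in [l] that converge uniformly on discs ([solution_family]), so
    [D(x, .)] is a locally uniform limit of polynomials. For such a function the
    maximum principle [max_principle] yields a Liouville theorem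
    ([liouville_zero]): it vanishes at [0] as soon as it tends to [0] at infinity.

    The decay of [D(x, l)] is read off in the variable [m] with [l = - m^2] and
    [Re m >= 0], splitting a solution into [m y - y^[1]] and [m y + y^[1]], which
    behave like [exp(- m x)] and [exp(m x)]. An energy estimate ([growth]) gives
    [c = O(exp(x Re m))] and [s = O(exp(x Re m) / m)], which settles the case of
    bounded [Re m]. When [Re m] is large, [psi] is dominated by its decaying
    component: [psi(x) = O(psi(0) exp(- x Re m))] ([decay]). This holds whatever
    the boundary polynomials are, because [m r1(- m^2)] has odd degree in [m] and
    [r2(- m^2)] even degree, so that one of them dominates the other
    ([dominance]). The same parity argument shows that the denominators of the
    Weyl functions do not vanish there, so that the equality of the Weyl functions
    says [psi(0) psit^[1](0) = psit(0) psi^[1](0)] ([weyl_cross]). Then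
    [D = s psit(x) / psit(0) - st psi(x) / psi(0)] and the exponentials cancel,
    leaving [O(1 / m)] ([cross_product_decay]).

    Once the potentials agree, the Wronskian of [psi] and [psit] is constant; it
    vanishes at [0], hence at [pi], where it reads [r2 r1t - r1 r2t]. Coprimality
    and the normalization then identify the boundary polynomials
    ([normalized_coprime_unique]).

    Solutions satisfy their equation only almost everywhere, so all of this rests
    on one fact about absolutely continuous functions: a nonpositive derivative
    a.e. makes them nonincreasing ([abs_cont_nonincreasing]). It turns every
    pointwise differential inequality into an integrated one. *)

(** * Absolutely continuous functions with a nonpositive derivative *)

Section RealAC.
Variable R : realType.
Implicit Types f g : R -> R.

(** Families over an arbitrary finite type, so that two families can be merged
    over the sum of their index types. *)
Definition abs_cont f := forall e : R, 0 < e -> exists2 d : R, 0 < d &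
  forall (I : finType) (a b : I -> R),
    (forall i, [/\ 0 <= a i, a i < b i & b i <= pi]) ->
    (forall i j, i != j -> b i <= a j \/ b j <= a i) ->
    \sum_i (b i - a i) < d -> \sum_i `|f (b i) - f (a i)| < e.

(** Cousin's lemma in the form of an induction on intervals: a property of
    intervals that is additive and holds on small intervals around each point
    holds globally. The supremum of the endpoints reached from [p] can be neither
    missed nor stopped at. *)
Lemma cousin_transport (p q : R) (Q : R -> R -> Prop) : p <= q ->
  (forall u, p <= u <= q -> Q u u) ->
  (forall u w v, p <= u -> u <= w -> w <= v -> v <= q ->
     Q u w -> Q w v -> Q u v) ->
  (forall x, p <= x <= q -> exists2 d, 0 < d & forall u v,
     p <= u -> u <= x -> x <= v -> v <= q -> x - d < u -> v < x + d -> Q u v) ->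
  Q p q.
Proof.
move=> pq Qr Qt Ql.
pose S := [set v | p <= v <= q /\ Q p v].
have Sp : S p by split; [rewrite lexx|apply: Qr; rewrite lexx].
have Sub : ubound S q by move=> v [/andP[_ ->]].
have hS : has_sup S by split; [exists p|exists q].
set s := sup S.
have ps : p <= s by apply: ub_le_sup => //; exists q.
have sq : s <= q by apply: ge_sup => //; exists p.
have [d d0 Qd] := Ql s (introT andP (conj ps sq)).
have [v [/andP[pv vq] Qpv] sdv] : exists2 v, S v & s - d < v.
  by apply: sup_adherent.
have vs : v <= s by apply: ub_le_sup => //; [exists q|split => //; rewrite pv].
have wq : Num.min q (s + d / 2) <= q by rewrite ge_min lexx.
have sw : s <= Num.min q (s + d / 2) by rewrite le_min sq /=; lra.
have Qvw : Q p (Num.min q (s + d / 2)).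
  apply: (Qt p v) => //; first by apply: le_trans sw.
  apply: Qd => //.
  by rewrite (le_lt_trans (y := s + d / 2)) // ?ge_min ?lexx ?orbT //; lra.
have : Num.min q (s + d / 2) <= s.
  apply: ub_le_sup => //; first by exists q.
  by split => //; rewrite wq andbT (le_trans ps).
rewrite ge_min => /orP[qs|]; last by lra.
have sqE : s = q by apply/le_anti/andP.
have -> // : q = Num.min q (s + d / 2).
rewrite sqE; apply/esym/min_idPl; lra.
Qed.

Lemma is_derive_increment f (x l e : R) : is_derive x (1 : R) f l -> 0 < e ->
  exists2 d, 0 < d & forall u v, u <= x -> x <= v -> x - d < u -> v < x + d ->
   f v - f u <= (l + e) * (v - u).
Proof.
move=> [df dfg] e0.
have H : h^-1 *: (f (h + x) - f x) @[h --> 0^'] --> l.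
  rewrite -dfg; have := df; rewrite /derivable => /cvg_ex[l1 hl].
  rewrite /derive (cvg_lim _ hl) //.
  apply: cvg_trans hl; apply: near_eq_cvg; near=> h.
  by rewrite /= [h *: 1]mulr1.
have /cvgrPdist_le/(_ _ e0) [d /= d0 Hd] := H.
exists d => // u v ux xv ud vd.
have K h : h != 0 -> `|h| < d -> `|f (h + x) - f x - l * h| <= e * `|h|.
  move=> h0 hd; have := Hd h; rewrite /= sub0r normrN => /(_ hd h0).
  rewrite /GRing.scale /= => HH.
  have -> : f (h + x) - f x - l * h = - (l - h^-1 * (f (h + x) - f x)) * h.
    by rewrite mulNr mulrBl mulrAC mulVf // mul1r; ring.
  by rewrite normrM normrN ler_wpM2r.
have fv : f v - f x <= (l + e) * (v - x).
  have [->|vx] := eqVneq v x; first by rewrite !subrr mulr0.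
  have := K (v - x); rewrite subr_eq0 vx ger0_norm ?subr_ge0 // subrK => /(_ isT).
  have vxd : v - x < d by lra.
  by move=> /(_ vxd); rewrite ler_norml; lra.
have fu : f x - f u <= (l + e) * (x - u).
  have [->|vx] := eqVneq u x; first by rewrite !subrr mulr0.
  have := K (u - x); rewrite subr_eq0 vx ler0_norm ?subr_le0 // subrK => /(_ isT).
  have vxd : - (u - x) < d by lra.
  by move=> /(_ vxd); rewrite ler_norml; lra.
lra.
Unshelve. all: by end_near. Qed.

End RealAC.

Section Mono.
Variable R : realType.
Implicit Types f g : R -> R.
Notation mu := (@lebesgue_measure R).

Lemma null_open_cover (N : set R) (e : R) : mu.-negligible N -> 0 < e ->
  exists2 O : set R, open O /\ N `<=` O & (mu O < e%:E)%E.
Proof.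
move=> [A [mA A0 NA]] e0.
have [|O [oO AO]] := lebesgue_regularity_outer mA _ e0;
  first by rewrite [X in (X < _)%E]A0 ltry.
have mO : measurable O by exact: open_measurable.
have OE : O = A `|` (O `\` A) by rewrite setDUK.
move=> Oe; exists O; first by split => //; exact: subset_trans AO.
rewrite OE measureU //;
  [by rewrite [X in (X + _)%E]A0 add0e|exact: measurableD|by rewrite setDIK].
Qed.

(* The measure of O on the left of x: its increments count how much of an
   interval lies in O. *)
Let mass (O : set R) (x : R) : R := fine (mu (O `&` `]-oo, x])).

Lemma mass_incr O (u v : R) : open O -> (mu O < +oo)%E -> u <= v ->
  ((mass O v - mass O u)%:E = mu (O `&` `]u, v]))%E.
Proof.
move=> oO Ofin uv.
have mO : measurable O by exact: open_measurable.
have fin A : measurable A -> mu (O `&` A) \is a fin_num.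
  move=> mA; rewrite ge0_fin_numE //; apply: le_lt_trans Ofin.
  by apply: le_measure; rewrite ?inE //; exact: measurableI.
have EI : [set` `]-oo, v]] = ([set` `]-oo, u]] `|` [set` `]u, v]]) :> set R.
  by rewrite -itv_bndbnd_setU // bnd_simp.
rewrite /mass EI EFinB [in X in (X - _)%E]fineK; last by apply: fin; apply: measurableU.
rewrite fineK; last exact: fin.
rewrite setIUr measureU //; first last.
- rewrite -subset0 => x /= [[_]]; rewrite !in_itv /= => xu [_ /andP[ux _]].
  by move: (le_lt_trans xu ux); rewrite ltxx.
- exact: measurableI.
- exact: measurableI.
by rewrite addeAC subee ?add0e // fin.
Qed.

(** At a point of differentiability, short intervals around it raise [f] by at
    most [e] times their length. The other points form a null set, which is covered
    by an open set [Oc] of small measure; intervals around them inside [Oc] are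
    collected in a family, and absolute continuity bounds their total contribution
    by [e]. Cousin's lemma adds the two kinds of intervals up. *)
Theorem abs_cont_nonincreasing f g (p q : R) : abs_cont f ->
  {ae mu, forall x : R, p < x < q -> is_derive x (1 : R) f (g x) /\ g x <= 0} ->
  0 <= p -> p <= q -> q <= pi -> f q <= f p.
Proof.
move=> acf aef p0 pq qpi.
rewrite leNgt; apply/negP => lt_pq.
(* The two contributions add up to less than e (q - p) + e, which is less
   than f q - f p. *)
pose e := (f q - f p) / (2 * (q - p + 2)).
have D0 : 0 < 2 * (q - p + 2) by lra.
have e0 : 0 < e by rewrite divr_gt0 // subr_gt0.
have eE : f q - f p = e * (2 * (q - p + 2)) by rewrite /e divfK // gt_eqF.
have [d d0 Hd] := acf e e0.
pose N := ~` [set x : R | p < x < q -> is_derive x (1 : R) f (g x) /\ g x <= 0]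
          `|` ([set p] `|` [set q]).
have negN : mu.-negligible N.
  apply: negligibleU; first exact: aef.
  apply: negligibleU; [exists [set p]|exists [set q]]; split => //;
    exact: lebesgue_measure_set1.
have [Oc [oO NO] Od] := null_open_cover negN d0.
have Ofin : (mu Oc < +oo)%E by rewrite (lt_trans Od) // ltry.
pose Good u v := exists (I : finType) (a b : I -> R),
  [/\ forall i, [/\ u <= a i, a i < b i & b i <= v],
      forall i j, i != j -> b i <= a j \/ b j <= a i,
      \sum_i (b i - a i) <= mass Oc v - mass Oc u &
      f v - f u <= e * (v - u) + \sum_i `|f (b i) - f (a i)| ].
have massle u v : u <= v -> 0 <= mass Oc v - mass Oc u.
  by move=> uv; rewrite -lee_fin mass_incr.
have good0 u v : u <= v -> f v - f u <= e * (v - u) -> Good u v.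
  move=> uv H; exists void, (fun=> 0), (fun=> 0); split => //; rewrite ?big_void ?addr0 //;
    try by case.
  by rewrite big_pred0 ?massle //; case.
  by rewrite big_pred0 ?addr0 //; case.
have [I [a [b [ab dis sm ff]]]] : Good p q.
  apply: cousin_transport => //.
  - by move=> u _; apply: good0 => //; rewrite !subrr mulr0.
  - move=> u w v pu uw wv vq [I [a [b [ab dis sm ff]]]] [J [a' [b' [ab' dis' sm' ff']]]].
    exists (I + J)%type, (fun k => match k with inl i => a i | inr j => a' j end),
      (fun k => match k with inl i => b i | inr j => b' j end); split.
    + case=> i; [have [? ? ?] := ab i|have [? ? ?] := ab' i]; split => //; lra.
    + case=> i [] j //.
      * by move=> ij; apply: dis; apply: contraNN ij => /eqP ->.
      * by move=> _; left; have [_ _ ?] := ab i; have [? _ _] := ab' j; lra.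
      * by move=> _; right; have [_ _ ?] := ab j; have [? _ _] := ab' i; lra.
      * by move=> ij; apply: dis'; apply: contraNN ij => /eqP ->.
    + rewrite big_sumType /=; lra.
    + rewrite big_sumType /=; lra.
  - move=> x /andP[px xq].
    have [xN|xN] := pselect (N x).
      have /= [d1 d10 Hd1] : \forall y \near x, Oc y.
        by apply: open_nbhs_nbhs; split => //; exact: NO.
      exists d1 => // u v pu ux xv vq ud vd.
      have [<-|uv] := eqVneq u v; first by apply: good0; rewrite ?subrr ?mulr0.
      have {}uv : u < v by rewrite lt_neqAle uv (le_trans ux).
      exists unit, (fun=> u), (fun=> v); split.
      + by move=> _.
      + by case=> - [].
      + rewrite big_const card_unit /= addr0 -lee_fin mass_incr //; last exact: ltW.
        rewrite setIidr.
          by rewrite lebesgue_measure_itv /= lte_fin uv.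
        move=> y; rewrite /= in_itv /= => /andP[uy yv]; apply: Hd1 => /=.
        rewrite ltr_norml; lra.
      + rewrite big_const card_unit /= addr0.
        by rewrite (le_trans (ler_norm _)) // lerDr mulr_ge0 ?subr_ge0 // ltW.
    have [Hnn /not_orP[xp xq']] : ~ ~ (p < x < q -> is_derive x (1 : R) f (g x) /\ g x <= 0)
        /\ ~ ([set p] `|` [set q]) x by apply/not_orP.
    have [Dx gx] : is_derive x (1 : R) f (g x) /\ g x <= 0.
      apply: (contrapT Hnn); rewrite !lt_neqAle px xq !andbT; apply/andP; split.
        by apply/eqP => E; apply: xp.
      by apply/eqP => E; apply: xq'.
    have [d1 d10 Hd1] := is_derive_increment Dx e0.
    exists d1 => // u v pu ux xv vq ud vd.
    apply: good0; first exact: le_trans xv.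
    apply: (le_trans (Hd1 u v ux xv ud vd)).
    by rewrite ler_wpM2r ?gerDr // subr_ge0 (le_trans ux).
have smd : \sum_i (b i - a i) < d.
  apply: le_lt_trans sm _.
  rewrite -lte_fin mass_incr //; apply: le_lt_trans Od.
  apply: le_measure; rewrite ?inE //; last exact: open_measurable.
  by apply: measurableI => //; exact: open_measurable.
have ab' i : [/\ 0 <= a i, a i < b i & b i <= pi].
  by have [? ? ?] := ab i; split => //; lra.
have := Hd I a b ab' dis smd => smf.
have X : 0 <= e * (q - p) by rewrite mulr_ge0 ?subr_ge0 // ltW.
have : f q - f p < e * (q - p) + e by lra.
rewrite eE; lra.
Qed.

End Mono.

(** * Calculus of absolutely continuous primitives *)

Section Calc.
Variable R : realType.
Implicit Types f g : R -> R.
Notation mu := (@lebesgue_measure R).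

Lemma ae_0pi_mp (P Q : R -> Prop) :
  (forall x, 0 < x < pi -> P x -> Q x) -> ae_0pi P -> ae_0pi Q.
Proof.
move=> PQ; apply: negligibleS; apply: subsetC => x Px x0.
by apply: PQ => //; exact: Px.
Qed.

Lemma ae_0pi_and (P Q : R -> Prop) :
  ae_0pi P -> ae_0pi Q -> ae_0pi (fun x => P x /\ Q x).
Proof.
move=> HP HQ; apply: (negligibleS _ (negligibleU HP HQ)); rewrite -setCI.
by apply: subsetC => x [Px Qx] x0; split; [exact: Px|exact: Qx].
Qed.

Lemma ae_0pi_all (P : R -> Prop) : (forall x, 0 < x < pi -> P x) -> ae_0pi P.
Proof. by move=> H; exact: aeW. Qed.

Definition ac_prim f g := abs_cont f /\ ae_0pi (fun x => is_derive x (1 : R) f (g x)).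

(** Every operation on absolutely continuous functions used here is Lipschitz
    in its arguments, and preserves absolute continuity for this reason. *)
Lemma abs_cont_comb f1 f2 f (C : R) : abs_cont f1 -> abs_cont f2 ->
  (forall u v, 0 <= u -> u <= v -> v <= pi ->
    `|f v - f u| <= C * (`|f1 v - f1 u| + `|f2 v - f2 u|)) -> abs_cont f.
Proof.
move=> ac1 ac2 H e e0.
have C0 : 0 < `|C| + 1 by rewrite ltr_pwDr.
have e'0 : 0 < e / (`|C| + 1) / 2 by rewrite !divr_gt0.
have [d1 d10 H1] := ac1 _ e'0; have [d2 d20 H2] := ac2 _ e'0.
exists (Num.min d1 d2); first by rewrite lt_min d10.
move=> I a b ab dis; rewrite lt_min => /andP[s1 s2].
have {}H1 := H1 I a b ab dis s1; have {}H2 := H2 I a b ab dis s2.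
apply: (@le_lt_trans _ _ (\sum_i (`|C| + 1) * (`|f1 (b i) - f1 (a i)| + `|f2 (b i) - f2 (a i)|))).
  apply: ler_sum => i _; have [a0 aib bpi] := ab i.
  apply: (le_trans (H _ _ a0 (ltW aib) bpi)); rewrite ler_wpM2r ?addr_ge0 //.
  by rewrite (le_trans (ler_norm C)) // lerDl.
rewrite -mulr_sumr big_split /= -ltr_pdivlMl // mulrC; lra.
Qed.

Lemma abs_cont_lip f (C : R) :
  (forall u v, 0 <= u -> u <= v -> v <= pi -> `|f v - f u| <= C * (v - u)) -> abs_cont f.
Proof.
move=> H; have rid : abs_cont (@id R).
  move=> e e0; exists e => // I a b ab _; apply: le_lt_trans; apply: ler_sum => i _.
  by have [_ ? _] := ab i; rewrite gtr0_norm // subr_gt0.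
apply: (@abs_cont_comb id id f (`|C|)) => // u v u0 uv vpi;
  apply: (le_trans (H _ _ u0 uv vpi)).
rewrite /= (ger0_norm (_ : 0 <= v - u)) ?subr_ge0 // mulrDr.
have : C * (v - u) <= `|C| * (v - u) by rewrite ler_wpM2r ?subr_ge0 ?ler_norm.
have : 0 <= `|C| * (v - u) by rewrite mulr_ge0 ?subr_ge0.
lra.
Qed.

Lemma abs_cont_near f e : abs_cont f -> 0 < e -> exists2 d, 0 < d &
  forall u v, 0 <= u -> u <= v -> v <= pi -> v - u < d -> `|f v - f u| < e.
Proof.
move=> acf e0; have [d d0 H] := acf e e0; exists d => // u v u0 uv vpi vud.
have [<-|nuv] := eqVneq u v; first by rewrite subrr normr0.
have := H unit (fun=> u) (fun=> v).
rewrite !big_const card_unit /= !addr0; apply => //; first by split => //;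
  rewrite lt_neqAle nuv.
Qed.

Lemma abs_cont_bounded f : abs_cont f -> exists B, forall x, 0 <= x <= pi -> `|f x| <= B.
Proof.
move=> acf; apply: (@cousin_transport R 0 pi
  (fun u v => exists B, forall x, u <= x <= v -> `|f x| <= B)).
- exact: pi_ge0.
- by move=> u _; exists `|f u| => x /le_anti <-.
- move=> u w v _ uw wv _ [B1 H1] [B2 H2]; exists (Num.max B1 B2) => x /andP[ux xv].
  by rewrite le_max; case: (leP x w) => xw; [rewrite H1 ?ux|rewrite H2 ?orbT // (ltW xw)].
- move=> x /andP[x0 xpi]; have [d d0 H] := abs_cont_near acf ltr01.
  exists (d / 2) => [|u v u0 ux xv vpi ud vd]; first by rewrite divr_gt0.
  exists (`|f u| + 1) => y /andP[uy yv].
  have := H u y u0 uy (le_trans yv vpi).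
  have yud : y - u < d by lra.
  move=> /(_ yud) fyu; have := ler_normD (f y - f u) (f u); rewrite subrK; lra.
Qed.

Lemma abs_cont_measurable f : abs_cont f -> measurable_fun (`]0, pi[ : set R) f.
Proof.
move=> acf; apply: open_continuous_measurable_fun; first exact: interval_open.
move=> x; rewrite inE /= in_itv /= => /andP[x0 xpi].
apply/cvgrPdist_lt => /= e e0; have [d d0 H] := abs_cont_near acf e0.
near=> t.
have [t0 tpi] : 0 < t /\ t < pi.
  by split; near: t; [exact: lt_nbhsr|exact: lt_nbhsl].
have : `|x - t| < d by near: t; apply: (nbhsx_ballx x d d0).
rewrite ltr_norml => xtd; have [xt|tx] := leP x t.
  by rewrite distrC H //; lra.
by rewrite H //; lra.
Unshelve. all: by end_near. Qed.

Lemma ac_prim_cst (c : R) : ac_prim (fun=> c) (fun=> 0).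
Proof.
split; first by apply: (@abs_cont_lip _ 0) => u v _ _ _; rewrite subrr normr0 mul0r.
by apply: ae_0pi_all => x _; exact: is_derive_cst.
Qed.

Lemma ac_primD f f' g g' : ac_prim f f' -> ac_prim g g' ->
  ac_prim (fun x => f x + g x) (fun x => f' x + g' x).
Proof.
move=> [acf df] [acg dg]; split.
  apply: (@abs_cont_comb _ _ _ 1 acf acg) => u v _ _ _; rewrite mul1r.
  by rewrite opprD addrACA ler_normD.
by apply: ae_0pi_mp (ae_0pi_and df dg) => x _ [? ?]; exact: is_deriveD.
Qed.

Lemma ac_primN f f' : ac_prim f f' -> ac_prim (fun x => - f x) (fun x => - f' x).
Proof.
move=> [acf df]; split.
  apply: (@abs_cont_comb _ _ _ 1 acf acf) => u v _ _ _; rewrite mul1r.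
  by rewrite -opprD normrN lerDl.
by apply: ae_0pi_mp df => x _ ?; exact: is_deriveN.
Qed.

Lemma ac_primM f f' g g' : ac_prim f f' -> ac_prim g g' ->
  ac_prim (fun x => f x * g x) (fun x => f' x * g x + f x * g' x).
Proof.
move=> [acf df] [acg dg]; split.
  have [B Bf] := abs_cont_bounded acf; have [C Cg] := abs_cont_bounded acg.
  apply: (@abs_cont_comb _ _ _ (`|B| + `|C|) acf acg) => u v u0 uv vpi.
  have -> : f v * g v - f u * g u = (f v - f u) * g v + f u * (g v - g u) by ring.
  have ub : `|f u| <= `|B|.
    by rewrite (le_trans (Bf u _)) ?ler_norm // u0 (le_trans uv).
  have vb : `|g v| <= `|C|.
    by rewrite (le_trans (Cg v _)) ?ler_norm // vpi (le_trans u0).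
  rewrite (le_trans (ler_normD _ _)) // !normrM.
  have := normr_ge0 (f v - f u); have := normr_ge0 (g v - g u).
  have := normr_ge0 B; have := normr_ge0 C; nra.
apply: ae_0pi_mp (ae_0pi_and df dg) => x _ [? ?].
apply: (is_derive_eq (is_deriveM _ _)).
by rewrite /GRing.scale /=; ring.
Qed.

(** The outer function need only be Lipschitz on bounded sets because an
    absolutely continuous function on a compact interval is bounded. *)
Lemma ac_prim_comp (phi phi' : R -> R) f f' :
  (forall x, is_derive x (1 : R) phi (phi' x)) ->
  (forall B, exists L, forall x, `|x| <= B -> `|phi' x| <= L) ->
  ac_prim f f' -> ac_prim (fun x => phi (f x)) (fun x => phi' (f x) * f' x).
Proof.
move=> dphi bphi [acf df]; split; last first.
  by apply: ae_0pi_mp df => x _ ?; exact: is_derive1_comp.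
have [B Bf] := abs_cont_bounded acf; have [L HL] := bphi B.
have lip u v : u <= v -> - B <= u -> v <= B -> `|phi v - phi u| <= L * (v - u).
  move=> uv Bu vB; have [|c] := @MVT_segment R phi phi' u v uv (fun x _ => dphi x).
    apply/continuous_subspaceT => x.
    exact/differentiable_continuous/derivable1_diffP/ex_derive.
  rewrite in_itv /= => /andP[uc cv] ->; rewrite normrM (ger0_norm (_ : 0 <=
    v - u)) ?subr_ge0 //.
  rewrite ler_wpM2r ?subr_ge0 // HL // ler_norml; lra.
apply: (@abs_cont_comb _ _ _ L acf acf) => u v u0 uv vpi /=.
have := Bf u; have := Bf v; rewrite u0 vpi (le_trans u0 uv) (le_trans uv vpi) !ler_norml.
move=> /(_ isT) /andP[? ?] /(_ isT) /andP[? ?].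
have L0 : 0 <= L by apply: le_trans (HL (f u) _) => //; rewrite ler_norml; lra.
rewrite -ler_norml; have [fuv|/ltW fvu] := leP (f u) (f v).
  have H : `|phi (f v) - phi (f u)| <= L * (f v - f u) by apply: lip => //; lra.
  have E : `|f v - f u| = f v - f u by rewrite ger0_norm ?subr_ge0.
  by apply: (le_trans H); rewrite E [leRHS]mulrDr lerDl mulr_ge0 // subr_ge0.
have H : `|phi (f u) - phi (f v)| <= L * (f u - f v) by apply: lip => //; lra.
have E : `|f v - f u| = f u - f v by rewrite distrC ger0_norm ?subr_ge0.
by rewrite distrC; apply: (le_trans H); rewrite E [leRHS]mulrDr lerDl mulr_ge0 // subr_ge0.
Qed.

Lemma ac_prim_ext f g f' : (forall x, 0 <= x <= pi -> f x = g x) -> ac_prim f f' ->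
  ac_prim g f'.
Proof.
move=> fg [acf df]; split.
  apply: (@abs_cont_comb _ _ _ 1 acf acf) => u v u0 uv vpi.
  rewrite mul1r -!fg ?lerDl //; rewrite ?u0 ?vpi ?andbT ?(le_trans u0) //=.
  exact: le_trans vpi.
apply: ae_0pi_mp df => x /andP[x0 xpi]; apply: near_eq_is_derive; near=> t.
apply: fg; apply/andP; split; apply: ltW; near: t; [exact: lt_nbhsr|exact: lt_nbhsl].
Unshelve. all: by end_near. Qed.

Lemma ac_prim_eq f f' g' : ae_0pi (fun x => f' x = g' x) -> ac_prim f f' -> ac_prim f g'.
Proof.
by move=> e [acf df]; split => //; apply: ae_0pi_mp (ae_0pi_and e df) => x _ [<-].
Qed.

(** A derivative that exists a.e. is determined by the function, so identities
    between functions can be differentiated. *)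
Lemma ac_prim_zero f f' : (forall x, 0 <= x <= pi -> f x = 0) -> ac_prim f f' ->
  ae_0pi (fun x => f' x = 0).
Proof.
move=> f0 pf.
have [_ d0] : ac_prim (fun=> 0) f' by apply: ac_prim_ext pf.
apply: ae_0pi_mp d0 => x _ d.
by rewrite -(@derive_val _ _ _ _ _ _ _ d) derive_cst.
Qed.

Lemma ac_prim_nonincreasing f g (p q : R) : ac_prim f g ->
  ae_0pi (fun x => p < x < q -> g x <= 0) ->
  0 <= p -> p <= q -> q <= pi -> f q <= f p.
Proof.
move=> [acf df] g0 p0 pq qpi; apply: (@abs_cont_nonincreasing R f g p q) => //.
apply: (negligibleS _ (ae_0pi_and df g0)); apply: subsetC => x H pxq.
have [|? ?] := H; first by case/andP: pxq => ? ?; lra.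
by split => //; auto.
Qed.

Lemma ac_prim_expR f f' : ac_prim f f' ->
  ac_prim (fun x => expR (f x)) (fun x => expR (f x) * f' x).
Proof.
apply: ac_prim_comp => B; exists (expR B) => x; rewrite ler_norml => /andP[_ xB].
by rewrite ger0_norm ?expR_ge0 // ler_expR.
Qed.

Lemma ac_prim_id : ac_prim (fun x => x) (fun=> 1).
Proof.
split; first by apply: (@abs_cont_lip _ 1) => u v _ uv _; rewrite mul1r ger0_norm ?subr_ge0.
by apply: ae_0pi_all => x _; exact: is_derive_id.
Qed.

Lemma ac_prim_lin (k : R) : ac_prim (fun x => k * x) (fun=> k).
Proof.
apply: ac_prim_eq (ac_primM (ac_prim_cst k) ac_prim_id); apply: ae_0pi_all => x _.
by rewrite mul0r add0r mulr1.
Qed.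

Lemma ac_prim_cos f f' : ac_prim f f' ->
  ac_prim (fun x => cos (f x)) (fun x => - sin (f x) * f' x).
Proof.
apply: ac_prim_comp => B; exists 1 => x _.
by rewrite normrN ler_norml sin_geN1 sin_le1.
Qed.

Lemma ac_prim_sin f f' : ac_prim f f' ->
  ac_prim (fun x => sin (f x)) (fun x => cos (f x) * f' x).
Proof.
apply: ac_prim_comp => B; exists 1 => x _.
by rewrite ler_norml cos_geN1 cos_le1.
Qed.

End Calc.

(** * Lebesgue integrals as absolutely continuous primitives *)

Section Prim.
Variable R : realType.
Implicit Types f g : R -> R.
Notation mu := (@lebesgue_measure R).

Definition integrable_0pi f := mu.-integrable (`]0, pi[ : set R) (EFin \o f).

(** Cutting [f] off outside the open interval makes the integrand integrable on
    the whole line, whatever its values at the endpoints and beyond. *)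
Definition integral0 f (x : R) : R :=
  (\int[mu]_(t in [set` Interval (BLeft 0) (BRight x)]) (f \_ (`]0, pi[ : set R)) t)%R.

(** Absolute continuity of the integral, spread over finitely many disjoint
    intervals: apply it to their union. *)
Lemma sum_disjoint_intervals_lt (f : R -> R) (e : R) :
  mu.-integrable setT (EFin \o f) -> 0 < e ->
  exists2 d : R, 0 < d & forall (I : finType) (a b : I -> R),
    (forall i, a i < b i) ->
    (forall i j, i != j -> b i <= a j \/ b j <= a i) ->
    \sum_i (b i - a i) < d ->
    \sum_i (\int[mu]_(t in [set` `]a i, b i]]) `|f t|)%R < e.
Proof.
move=> intf e0; have [d [d0 Hd]] := integral_normr_continuous intf e0.
exists d => // I a b ab dis sd.
pose F i : set R := [set` `]a i, b i]].
have mF i : measurable (F i) by exact: measurable_itv.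
have tF : trivIset [set` index_enum I] F.
  move=> i j _ _ [x []]; rewrite /F /= !in_itv /= => /andP[ax xb] /andP[ax' xb'].
  apply: contrapT => /eqP ij; case: (dis i j ij) => H.
    by have := lt_le_trans (le_lt_trans H ax') xb; rewrite ltxx.
  by have := lt_le_trans (le_lt_trans H ax) xb'; rewrite ltxx.
pose D := \big[setU/set0]_(i <- index_enum I) F i.
have mD : measurable D by apply: bigsetU_measurable.
pose nf_ : R -> R := fun x => `|f x|.
have nf : measurable_fun D (EFin \o nf_).
  apply/measurable_EFinP/measurableT_comp => //.
  by apply: measurable_funTS; case/integrableP : intf => /measurable_EFinP.
have muD : (mu D = (\sum_i (b i - a i))%:E)%E.
  have := @ge0_integral_bigsetU _ _ R mu I F (cst 1%E) _ mF (index_enum_uniq I) tF.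
  rewrite -/D => /(_ (measurable_cst _)) H.
  transitivity (\int[mu]_(x in D) (cst 1%E x))%E; first by rewrite integral_cst // mul1e.
  rewrite H // -sumEFin; apply: eq_bigr => i _.
  rewrite integral_cst; last exact: mF.
  have := @lebesgue_measure_itv R `]a i, b i]; rewrite /= lte_fin ab => E.
  by rewrite [X in (_ * X)%E]E mul1e.
have := Hd D mD; rewrite [X in (X < _)%E -> _](muD) lte_fin => /(_ sd).
apply: le_lt_trans.
rewrite /Rintegral -lee_fin -sumEFin.
have int_abs A : measurable A -> mu.-integrable A (EFin \o nf_).
  by move=> mA; apply: (@integrableS _ _ R mu setT) => //; exact: (integrable_abse intf).
rewrite (eq_bigr (fun i => \int[mu]_(t in F i) `|f t|%:E)%E); last first.
  by move=> i _; rewrite fineK //; apply: integrable_fin_num => //; exact: int_abs.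
rewrite fineK; last by apply: integrable_fin_num => //; exact: int_abs.
by rewrite (@ge0_integral_bigsetU _ _ R mu I F _ _ mF (index_enum_uniq I) tF).
Qed.

(** The derivative is Lebesgue's differentiation theorem. *)
Lemma integral0_ac_prim f : integrable_0pi f -> ac_prim (integral0 f) f.
Proof.
move=> intf.
have mJ : measurable (`]0, pi[%classic : set R) by exact: measurable_itv.
pose f0 := f \_ (`]0, pi[ : set R).
have intf0 : mu.-integrable setT (EFin \o f0).
  rewrite /f0 -restrict_EFin; apply/integrable_restrict => //=; rewrite setTI.
  exact: intf.
have intA A : measurable A -> mu.-integrable A (EFin \o f0).
  by move=> mA; apply: (@integrableS _ _ R mu setT).
split.
  move=> e e0; have [d d0 H] := sum_disjoint_intervals_lt intf0 e0.
  exists d => // I a b ab dis sd.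
  apply: le_lt_trans (H I a b _ dis sd); last by move=> i; have [] := ab i.
  apply: ler_sum => i _; have [a0 aib bpi] := ab i.
  rewrite /integral0 -/f0 Rintegral_itvB //; last 2 first.
  - exact: intA.
  - by rewrite bnd_simp ltW.
  by apply: le_normr_Rintegral => //; exact: intA.
have lf0 : locally_integrable setT f0 by exact: integrable_locally.
have := @FTC1 R f0 (BLeft 0) (fun y => intA _ (measurable_itv _)) lf0.
apply: negligibleS; apply: subsetC => x Hx /andP[x0 xpi] /=.
have [|dF FE] := Hx; first by rewrite lte_fin.
have -> : f x = f0 x by rewrite /f0 patchE mem_set //= in_itv /= x0.
rewrite -FE derive1E; exact: derivableP.
Qed.

Lemma integral0_at0 f : integral0 f 0 = 0.
Proof. by rewrite /integral0 set_itv1 Rintegral_set1. Qed.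

End Prim.

(** The modulus with values in the real field; the norm of a complex number takes
    its values in the complex field, where real inequalities are harder to combine. *)
Local Notation cn := (@Normc.normc _).

(** * Complex-valued absolutely continuous functions *)

Section CCalc.
Variable R : realType.
Notation C := R[i].
Implicit Types (f g : R -> C) (z w : C).

Lemma ReD z w : complex.Re (z + w) = complex.Re z + complex.Re w.
Proof. by case: z w => ? ? []. Qed.
Lemma ImD z w : complex.Im (z + w) = complex.Im z + complex.Im w.
Proof. by case: z w => ? ? []. Qed.
Lemma ReN z : complex.Re (- z) = - complex.Re z.
Proof. by case: z. Qed.
Lemma ImN z : complex.Im (- z) = - complex.Im z.
Proof. by case: z. Qed.
Lemma ReM z w : complex.Re (z * w) =
  complex.Re z * complex.Re w - complex.Im z * complex.Im w.
Proof. by case: z w => ? ? []. Qed.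
Lemma ImM z w : complex.Im (z * w) =
  complex.Re z * complex.Im w + complex.Im z * complex.Re w.
Proof. by case: z w => ? ? []. Qed.

Lemma complex_eq z w : complex.Re z = complex.Re w -> complex.Im z = complex.Im w -> z = w.
Proof. by case: z w => ? ? [? ?] /= -> ->. Qed.

Lemma cnE z : `|z| = (cn z)%:C.
Proof. by []. Qed.

Lemma cn_ge0 z : 0 <= cn z.
Proof. by rewrite -ler0c -cnE normr_ge0. Qed.

Lemma cnD z w : cn (z + w) <= cn z + cn w.
Proof. exact: (@le_normcD R z w). Qed.

Lemma cnM z w : cn (z * w) = cn z * cn w.
Proof. exact: Normc.normcM. Qed.

Lemma cnN z : cn (- z) = cn z.
Proof. exact: (@normcN R z). Qed.

Lemma cnB z w : cn (z - w) <= cn z + cn w.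
Proof. by rewrite -(cnN w) cnD. Qed.

Lemma cn0 : cn (0 : C) = 0. Proof. exact: Normc.normc0. Qed.
Lemma cn1 : cn (1 : C) = 1. Proof. exact: Normc.normc1. Qed.

Lemma cn_eq0 z : (cn z == 0) = (z == 0).
Proof.
by apply/eqP/eqP => [/Normc.eq0_normc|->] //; rewrite cn0.
Qed.

Lemma cn_gt0 z : (0 < cn z) = (z != 0).
Proof. by rewrite lt_neqAle cn_ge0 andbT eq_sym cn_eq0. Qed.

Lemma cnV z : cn z^-1 = (cn z)^-1. Proof. exact: Normc.normcV. Qed.

Lemma cnX z n : cn (z ^+ n) = cn z ^+ n.
Proof. by elim: n => [|n IH]; rewrite ?expr0 ?cn1 // !exprS cnM IH. Qed.

Lemma cn_real (x : R) : cn x%:C = `|x|.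
Proof. by rewrite /= expr0n /= addr0 sqrtr_sqr. Qed.

Lemma cn_sq z : cn z ^+ 2 = complex.Re z ^+ 2 + complex.Im z ^+ 2.
Proof. by case: z => x y /=; rewrite sqr_sqrtr // addr_ge0 ?sqr_ge0. Qed.

Lemma Re_le_cn z : `|complex.Re z| <= cn z.
Proof.
rewrite -(ler_pXn2r (_ : 0 < 2)%N) ?nnegrE ?cn_ge0 // cn_sq real_normK ?num_real //.
by rewrite lerDl sqr_ge0.
Qed.

Lemma Im_le_cn z : `|complex.Im z| <= cn z.
Proof.
rewrite -(ler_pXn2r (_ : 0 < 2)%N) ?nnegrE ?cn_ge0 // cn_sq real_normK ?num_real //.
by rewrite lerDr sqr_ge0.
Qed.

Lemma cn_le_ReIm z : cn z <= `|complex.Re z| + `|complex.Im z|.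
Proof.
rewrite -(ler_pXn2r (_ : 0 < 2)%N) ?nnegrE ?cn_ge0 ?addr_ge0 // cn_sq.
rewrite sqrrD !real_normK ?num_real //.
have := mulr_ge0 (normr_ge0 (complex.Re z)) (normr_ge0 (complex.Im z)).
by rewrite mulr2n; lra.
Qed.

Definition ac_cprim f g :=
  ac_prim (fun x => complex.Re (f x)) (fun x => complex.Re (g x)) /\
  ac_prim (fun x => complex.Im (f x)) (fun x => complex.Im (g x)).

Lemma ac_cprim_cst z : ac_cprim (fun=> z) (fun=> 0).
Proof. by split; exact: ac_prim_cst. Qed.

Lemma ac_cprim_eq f g g' : ae_0pi (fun x => g x = g' x) -> ac_cprim f g -> ac_cprim f g'.
Proof.
by move=> e [pr pi]; split; [apply: ac_prim_eq pr|apply: ac_prim_eq pi];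
  apply: ae_0pi_mp e => x _ ->.
Qed.

Lemma ac_cprim_feq f g g' : (forall x, 0 < x < pi -> g x = g' x) -> ac_cprim f g ->
  ac_cprim f g'.
Proof. by move=> e; apply: ac_cprim_eq; apply: ae_0pi_all. Qed.

Lemma ac_cprim_ext f f' g : (forall x, 0 <= x <= pi -> f x = f' x) -> ac_cprim f g ->
  ac_cprim f' g.
Proof.
by move=> e [pr pi]; split; [apply: ac_prim_ext pr|apply: ac_prim_ext pi] => x xpi;
  rewrite e.
Qed.

Lemma eq_ac_prim (f f' g g' : R -> R) : f =1 f' -> g =1 g' -> ac_prim f g -> ac_prim f' g'.
Proof. by move=> /funext -> /funext ->. Qed.

Lemma ac_cprimD f f' g g' : ac_cprim f f' -> ac_cprim g g' ->
  ac_cprim (fun x => f x + g x) (fun x => f' x + g' x).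
Proof.
move=> [fr fi] [gr gi]; split.
  by apply: eq_ac_prim (ac_primD fr gr) => x; rewrite ReD.
by apply: eq_ac_prim (ac_primD fi gi) => x; rewrite ImD.
Qed.

Lemma ac_cprimN f f' : ac_cprim f f' -> ac_cprim (fun x => - f x) (fun x => - f' x).
Proof.
move=> [fr fi]; split.
  by apply: eq_ac_prim (ac_primN fr) => x; rewrite ReN.
by apply: eq_ac_prim (ac_primN fi) => x; rewrite ImN.
Qed.

Lemma ac_cprimB f f' g g' : ac_cprim f f' -> ac_cprim g g' ->
  ac_cprim (fun x => f x - g x) (fun x => f' x - g' x).
Proof. by move=> pf pg; apply: ac_cprimD pf (ac_cprimN pg). Qed.

Lemma ac_cprimM f f' g g' : ac_cprim f f' -> ac_cprim g g' ->
  ac_cprim (fun x => f x * g x) (fun x => f' x * g x + f x * g' x).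
Proof.
move=> [fr fi] [gr gi]; split.
  apply: eq_ac_prim (ac_primD (ac_primM fr gr) (ac_primN (ac_primM fi gi))) => x.
    by rewrite ReM.
  by rewrite ReD !ReM; ring.
apply: eq_ac_prim (ac_primD (ac_primM fr gi) (ac_primM fi gr)) => x.
  by rewrite ImM.
by rewrite ImD !ImM; ring.
Qed.

Lemma ac_cprimZ z f f' : ac_cprim f f' -> ac_cprim (fun x => z * f x) (fun x => z * f' x).
Proof.
move=> pf; apply: ac_cprim_feq (ac_cprimM (ac_cprim_cst z) pf) => x _.
by rewrite mul0r add0r.
Qed.

Lemma ac_cprim_sum (I : Type) (r : seq I) (F F' : I -> R -> C) :
  (forall i, ac_cprim (F i) (F' i)) ->
  ac_cprim (fun x => \sum_(i <- r) F i x) (fun x => \sum_(i <- r) F' i x).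
Proof.
move=> H; elim: r => [|i r IH].
  have -> : (fun x => \sum_(i <- [::]) F i x) = (fun=> 0) by apply/funext => x;
    rewrite big_nil.
  have -> : (fun x => \sum_(i <- [::]) F' i x) = (fun=> 0) by apply/funext => x;
    rewrite big_nil.
  exact: ac_cprim_cst.
have -> : (fun x => \sum_(j <- i :: r) F j x) = (fun x => F i x + \sum_(j <- r) F j x).
  by apply/funext => x; rewrite big_cons.
have -> : (fun x => \sum_(j <- i :: r) F' j x) = (fun x => F' i x + \sum_(j <- r) F' j x).
  by apply/funext => x; rewrite big_cons.
exact: ac_cprimD.
Qed.

Lemma abs_cont_of_complex (u : C -> R) f :
  (forall z w, `|u z - u w| <= cn (z - w)) ->
  abs_continuous_0pi f -> abs_cont (fun x => u (f x)).
Proof.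
move=> ul acf e e0; have [d d0 H] := acf e e0; exists d => // I a b ab dis sd.
have := H #|I| (fun i => a (enum_val i)) (fun i => b (enum_val i)).
have sumE (V : zmodType) (F : I -> V) : \sum_i F i = \sum_(i < #|I|) F (enum_val i).
  by rewrite (reindex (@enum_val I xpredT)) //=; exact/onW_bij/enum_val_bij.
rewrite -(sumE R (fun i => b i - a i)) -(sumE C (fun i => `|f (b i) - f (a i)|)).
move=> /(_ (fun i => ab _)) H1.
have : \sum_i `|f (b i) - f (a i)| < e%:C.
  apply: H1 => // i j ij; apply: dis; apply: contraNN ij => /eqP E.
  by apply/eqP/enum_val_inj.
rewrite (eq_bigr (fun i => (cn (f (b i) - f (a i)))%:C)) //.
rewrite -(rmorph_sum (real_complex R)) /= ltcR; apply: le_lt_trans.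
by apply: ler_sum => i _; exact: ul.
Qed.

Lemma ac_cprim_of_has_deriv f g : abs_continuous_0pi f ->
  ae_0pi (fun x => has_deriv f x (g x)) -> ac_cprim f g.
Proof.
move=> acf df; split; split.
- by apply: (@abs_cont_of_complex (@complex.Re R)) acf => z w; rewrite -ReN -ReD Re_le_cn.
- by apply: ae_0pi_mp df => x _ [].
- by apply: (@abs_cont_of_complex (@complex.Im R)) acf => z w; rewrite -ImN -ImD Im_le_cn.
- by apply: ae_0pi_mp df => x _ [].
Qed.

(** A mean value inequality: project the increment of [f] on its own direction and
    compare this real function with [G]. *)
Lemma ac_cprim_le f f' (G G' : R -> R) (p q : R) : ac_cprim f f' -> ac_prim G G' ->
  ae_0pi (fun x => p < x < q -> cn (f' x) <= G' x) ->
  0 <= p -> p <= q -> q <= pi -> cn (f q - f p) <= G q - G p.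
Proof.
move=> pf pG H p0 pq qpi.
have [E0|E0] := eqVneq (f q - f p) 0.
  rewrite E0 cn0 subr_ge0 -lerN2.
  apply: (@ac_prim_nonincreasing R _ _ p q (ac_primN pG)) => //.
  apply: ae_0pi_mp H => x _ H /H H'; rewrite oppr_le0; exact: le_trans (cn_ge0 _) H'.
(* The unit direction of the increment. *)
pose u := (f q - f p)^*%C / (cn (f q - f p))%:C.
have n0 : cn (f q - f p) != 0 by rewrite cn_eq0.
have cu : cn u = 1.
  rewrite /u cnM cnV cn_real ger0_norm ?cn_ge0 //.
  have -> : cn (f q - f p)^*%C = cn (f q - f p).
    by case: (f q - f p) => x y /=; rewrite sqrrN.
  by rewrite divff.
have uf : complex.Re (u * (f q - f p)) = cn (f q - f p).
  rewrite /u mulrAC mulrC ReM.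
  have -> : complex.Re (cn (f q - f p))%:C^-1 = (cn (f q - f p))^-1.
    by rewrite -fmorphV.
  have -> : complex.Im (cn (f q - f p))%:C^-1 = 0 by rewrite -fmorphV.
  rewrite mul0r subr0.
  have -> : complex.Re ((f q - f p)^*%C * (f q - f p)) = cn (f q - f p) ^+ 2.
    by rewrite cn_sq; case: (f q - f p) => x y /=; ring.
  by rewrite expr2 mulKf.
have [pr _] := ac_cprimZ u pf.
have := ac_prim_nonincreasing (ac_primD pr (ac_primN pG)) _ p0 pq qpi.
rewrite -uf mulrBr ReD ReN => K; suff : complex.Re (u * f q) - G q <=
  complex.Re (u * f p) - G p by lra.
apply: K; apply: ae_0pi_mp H => x _ H /H H'.
rewrite subr_le0; apply: le_trans H'.
by rewrite -[leRHS]mul1r -cu -cnM (le_trans _ (Re_le_cn _)) // ler_norm.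
Qed.

Lemma ac_cprim_const f f' : ac_cprim f f' -> ae_0pi (fun x => f' x = 0) ->
  forall x, 0 <= x <= pi -> f x = f 0.
Proof.
move=> pf H x /andP[x0 xpi]; apply/eqP; rewrite -subr_eq0 -cn_eq0 eq_le cn_ge0 andbT.
have := ac_cprim_le pf (ac_prim_cst 0) _ (lexx 0) x0 xpi.
rewrite subrr; apply; apply: ae_0pi_mp H => y _ -> _.
by rewrite cn0.
Qed.

Lemma ac_cprim_zero f f' : ac_cprim f f' -> (forall x, 0 <= x <= pi -> f x = 0) ->
  ae_0pi (fun x => f' x = 0).
Proof.
move=> [pr pi] H.
have Hr := ac_prim_zero (fun x xpi => congr1 (@complex.Re R) (H x xpi)) pr.
have Hi := ac_prim_zero (fun x xpi => congr1 (@complex.Im R) (H x xpi)) pi.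
apply: ae_0pi_mp (ae_0pi_and Hr Hi) => x _ [hr hi].
exact: complex_eq.
Qed.

(** The square of [f] has derivative [2 f f'], which vanishes a.e., so it is
    constant. *)
Lemma ac_cprim_ae0 f f' : ac_cprim f f' -> ae_0pi (fun x => f x = 0) -> f 0 = 0 ->
  forall x, 0 <= x <= pi -> f x = 0.
Proof.
move=> pf H f0 x xpi; have := ac_cprim_const (ac_cprimM pf pf) _ xpi.
rewrite f0 mulr0 => E; apply/eqP; rewrite -sqrf_eq0 expr2; apply/eqP/E.
by apply: ae_0pi_mp H => y _ ->; rewrite mulr0 mul0r addr0.
Qed.

Lemma ac_cprim_sqnorm f f' : ac_cprim f f' ->
  ac_prim (fun x => cn (f x) ^+ 2)
        (fun x => 2 * complex.Re ((f x)^*%C * f' x)).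
Proof.
move=> [fr fi]; apply: eq_ac_prim (ac_primD (ac_primM fr fr) (ac_primM fi fi)) => x.
  by rewrite cn_sq !expr2.
by rewrite ReM; case: (f x) => a b; case: (f' x) => c d /=; ring.
Qed.

Definition cintegrable f := integrable_0pi (fun x => complex.Re (f x)) /\
  integrable_0pi (fun x => complex.Im (f x)).

Definition cintegral0 f x : C :=
  integral0 (fun x => complex.Re (f x)) x +i* integral0 (fun x => complex.Im (f x)) x.

Lemma cintegral0_ac_cprim f : cintegrable f -> ac_cprim (cintegral0 f) f.
Proof. by move=> [fr fi]; split; exact: integral0_ac_prim. Qed.

Lemma cintegral0_at0 f : cintegral0 f 0 = 0.
Proof. by rewrite /cintegral0 !integral0_at0. Qed.

End CCalc.

(** * Integrability and the weight of a square integrable potential *)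

Section Integ.
Variable R : realType.
Notation C := R[i].
Notation mu := (@lebesgue_measure R).
Notation J := (`]0, pi[%classic : set R).
Implicit Types (f g : R -> C).

Let mJ : measurable J. Proof. exact: measurable_itv. Qed.

Lemma integrable_0pi_cst (c : R) : integrable_0pi (fun=> c).
Proof.
apply: (@measurable_bounded_integrable _ _ R mu (fun=> c) J mJ).
- have := @lebesgue_measure_itv R `]0, pi[; rewrite /= lte_fin pi_gt0 => E.
  by rewrite [X in (X < _)%E]E ltry.
- exact: measurable_cst.
- by exists `|c|; split; [exact: num_real|move=> x cx y _; exact: ltW].
Qed.

Lemma integrable_0piD (f g : R -> R) : integrable_0pi f -> integrable_0pi g ->
  integrable_0pi (fun x => f x + g x).
Proof.
by move=> fi gi; apply: (integrableD _ fi gi); exact: measurable_itv.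
Qed.

Lemma integrable_0pi_dom (f g : R -> R) (K : R) : measurable_fun J f ->
  integrable_0pi g -> (forall x, 0 < x < pi -> `|f x| <= K * g x) -> integrable_0pi f.
Proof.
move=> mf gi H.
have Kgi : mu.-integrable J (fun x => (K%:E * (EFin \o g) x)%E) by apply: integrableZl gi; exact: measurable_itv.
apply: (le_integrable _ _ _ Kgi); [exact: measurable_itv|exact/measurable_EFinP|].
move=> x; rewrite /= in_itv /= => xJ; rewrite lee_fin.
by apply: (le_trans (H x xJ)); rewrite ler_norm.
Qed.

Definition cmeas f := measurable_fun J (fun x => complex.Re (f x)) /\
  measurable_fun J (fun x => complex.Im (f x)).

Let mfun_ext (u v : R -> R) : u =1 v -> measurable_fun J u -> measurable_fun J v.
Proof. by move=> /funext ->. Qed.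

Lemma cmeasD f g : cmeas f -> cmeas g -> cmeas (fun x => f x + g x).
Proof.
move=> [fr fi] [gr gi]; split.
  by apply: mfun_ext (measurable_funD fr gr) => x /=; rewrite ReD.
by apply: mfun_ext (measurable_funD fi gi) => x /=; rewrite ImD.
Qed.

Lemma cmeasM f g : cmeas f -> cmeas g -> cmeas (fun x => f x * g x).
Proof.
move=> [fr fi] [gr gi]; split.
  apply: mfun_ext (measurable_funB (measurable_funM fr gr) (measurable_funM fi gi)).
  by move=> x /=; rewrite ReM.
apply: mfun_ext (measurable_funD (measurable_funM fr gi) (measurable_funM fi gr)).
by move=> x /=; rewrite ImM.
Qed.

Lemma cmeas_cst (c : C) : cmeas (fun=> c).
Proof. by split; exact: measurable_cst. Qed.

Lemma cmeasN f : cmeas f -> cmeas (fun x => - f x).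
Proof.
move=> fm; have -> : (fun x => - f x) = (fun x => (-1) * f x).
  by apply/funext => x; rewrite mulN1r.
exact: cmeasM (cmeas_cst _) fm.
Qed.

Lemma ac_cprim_cmeas f g : ac_cprim f g -> cmeas f.
Proof. by move=> [[fr _] [fi _]]; split; exact: abs_cont_measurable. Qed.

Lemma ac_cprim_bounded f g : ac_cprim f g -> exists B, forall x, 0 <= x <= pi ->
  cn (f x) <= B.
Proof.
move=> [[/abs_cont_bounded [B1 H1] _] [/abs_cont_bounded [B2 H2] _]];
  exists (B1 + B2) => x xpi.
by rewrite (le_trans (cn_le_ReIm _)) // lerD ?H1 ?H2.
Qed.

Lemma cintegrable_dom f (h : R -> R) (K : R) : cmeas f -> integrable_0pi h ->
  (forall x, 0 < x < pi -> cn (f x) <= K * h x) -> cintegrable f.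
Proof.
move=> [fr fi] hi H; split; apply: (integrable_0pi_dom _ hi (K := K)) => // x xJ;
  apply: le_trans (H x xJ); [exact: Re_le_cn|exact: Im_le_cn].
Qed.

(** A single integrable function that dominates [1], [|sigma|] and [|sigma|^2]. *)
Definition weight (sigma : R -> C) (x : R) : R := 1 + cn (sigma x) ^+ 2.

Lemma weight_ge1 sigma x : 1 <= weight sigma x.
Proof. by rewrite /weight lerDl exprn_ge0 ?cn_ge0. Qed.

Lemma cn_le_weight sigma x : cn (sigma x) <= weight sigma x.
Proof. by rewrite /weight; have := sqr_ge0 (cn (sigma x) - 1); nra. Qed.

Lemma cnsq_le_weight sigma x : cn (sigma x) ^+ 2 <= weight sigma x.
Proof. by rewrite /weight lerDr. Qed.

Lemma weight_integrable sigma : L2_0pi sigma -> integrable_0pi (weight sigma).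
Proof.
move=> [[_ sr] [_ si]].
have -> : weight sigma = (fun x => 1 + (complex.Re (sigma x) ^+ 2 + complex.Im (sigma x) ^+ 2)).
  by apply/funext => x; rewrite /weight cn_sq.
by apply: integrable_0piD (integrable_0pi_cst _) (integrable_0piD sr si).
Qed.

Definition weight_int sigma : R -> R := integral0 (weight sigma).

Lemma weight_int_ac_prim sigma : L2_0pi sigma -> ac_prim (weight_int sigma) (weight sigma).
Proof. by move/weight_integrable/integral0_ac_prim. Qed.

Lemma weight_int0 sigma : weight_int sigma 0 = 0. Proof. exact: integral0_at0. Qed.

Lemma weight_int_le sigma x y : L2_0pi sigma -> 0 <= x -> x <= y -> y <= pi ->
  weight_int sigma x <= weight_int sigma y.
Proof.
move=> sL x0 xy ypi; rewrite -lerN2.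
apply: (ac_prim_nonincreasing (ac_primN (weight_int_ac_prim sL))) => //.
by apply: ae_0pi_all => t _ _; rewrite oppr_le0 (le_trans _ (weight_ge1 _ _)).
Qed.

Lemma weight_int_ge0 sigma x : L2_0pi sigma -> 0 <= x <= pi -> 0 <= weight_int sigma x.
Proof. by move=> sL /andP[x0 xpi]; rewrite -(weight_int0 sigma) weight_int_le. Qed.

Lemma L2_cmeas sigma : L2_0pi sigma -> cmeas sigma.
Proof. by move=> [[? _] [? _]]. Qed.

End Integ.

(** * Geometrically convergent sequences *)

Section Limits.
Variable R : realType.
Notation C := R[i].

(** The limit is the common bound of the nondecreasing sequence
    [u n - 2 K / 2^n] and the nonincreasing sequence [u n + 2 K / 2^n]. *)
Lemma geometric_limit (u : nat -> R) (K : R) :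
  (forall n, `|u n.+1 - u n| <= K / 2 ^+ n) ->
  exists l, forall n, `|u n - l| <= 2 * K / 2 ^+ n.
Proof.
move=> H.
have K0 : 0 <= K by have := H 0%N; rewrite expr0 divr1; exact: le_trans.
have q n : 2 * K / 2 ^+ n = 2 * (2 * K / 2 ^+ n.+1).
  by rewrite exprS invfM; field; rewrite expf_neq0.
have q' n : K / 2 ^+ n = 2 * K / 2 ^+ n.+1 by rewrite exprS invfM; field; rewrite expf_neq0.
have vmono n m : (n <= m)%N -> u n - 2 * K / 2 ^+ n <= u m - 2 * K / 2 ^+ m.
  elim: m => [|m IH]; first by rewrite leqn0 => /eqP ->.
  rewrite leq_eqVlt => /orP[/eqP -> //|/IH /le_trans]; apply.
  by have := H m; rewrite q' ler_norml (q m); lra.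
have wmono n m : (n <= m)%N -> u m + 2 * K / 2 ^+ m <= u n + 2 * K / 2 ^+ n.
  elim: m => [|m IH]; first by rewrite leqn0 => /eqP ->.
  rewrite leq_eqVlt => /orP[/eqP -> //|/IH]; apply: le_trans.
  by have := H m; rewrite q' ler_norml (q m); lra.
have e0 n : 0 <= 2 * K / 2 ^+ n by rewrite divr_ge0 ?mulr_ge0 ?exprn_ge0.
pose S := range (fun n => u n - 2 * K / 2 ^+ n).
have ubS n : ubound S (u n + 2 * K / 2 ^+ n).
  move=> _ [m _ <-]; have [nm|/ltnW mn] := leqP n m.
    by have := wmono _ _ nm; have := e0 m; lra.
  by have := vmono _ _ mn; have := e0 n; lra.
exists (sup S) => n.
have l1 : u n - 2 * K / 2 ^+ n <= sup S.
  by apply: ub_le_sup; [exists (u 0%N + 2 * K / 2 ^+ 0); exact: ubS|exists n].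
have l2 : sup S <= u n + 2 * K / 2 ^+ n.
  by apply: ge_sup; [exists (u 0%N - 2 * K / 2 ^+ 0); exists 0%N|exact: ubS].
by rewrite ler_norml; lra.
Qed.

Lemma cgeometric_limit (u : nat -> C) (K : R) :
  (forall n, cn (u n.+1 - u n) <= K / 2 ^+ n) ->
  exists l, forall n, cn (u n - l) <= 4 * K / 2 ^+ n.
Proof.
move=> H.
have [lr Hr] := @geometric_limit (fun n => complex.Re (u n)) K
   (fun n => ltac:(rewrite -ReN -ReD; exact: le_trans (Re_le_cn _) (H n))).
have [li Hi] := @geometric_limit (fun n => complex.Im (u n)) K
   (fun n => ltac:(rewrite -ImN -ImD; exact: le_trans (Im_le_cn _) (H n))).
exists (lr +i* li) => n; apply: (le_trans (cn_le_ReIm _)).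
rewrite ReD ImD ReN ImN /=; have := Hr n; have := Hi n; lra.
Qed.

Lemma small_geometric (K e : R) : 0 < e -> exists n, K / 2 ^+ n <= e.
Proof.
move=> e0; exists (Num.truncn (`|K| / e)).+1.
rewrite ler_pdivrMr ?exprn_gt0 //; apply: (le_trans (ler_norm K)).
rewrite mulrC -ler_pdivrMr //.
set m := (Num.truncn _).+1.
have : `|K| / e < m%:R by rewrite truncnS_gt.
move/ltW/le_trans; apply.
by rewrite -natrX ler_nat ltnW // ltn_expl.
Qed.

End Limits.

(** * Solutions of the equation and their Picard iterates *)

Section Solutions.
Variable R : realType.
Notation C := R[i].

(** The equation as a first order system for [y] and its quasi-derivative [v]. *)
Definition solves (sigma : R -> C) (lambda : C) (y v : R -> C) :=
  ac_cprim y (fun x => v x + sigma x * y x) /\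
  ac_cprim v (fun x => - sigma x * v x - sigma x ^+ 2 * y x - lambda * y x).

Lemma is_solution_solves sigma lambda y v :
  is_solution sigma lambda y v -> solves sigma lambda y v.
Proof.
move=> [acy acv dy dv]; split; apply: ac_cprim_of_has_deriv => //.
  by apply: ae_0pi_mp dy => x _ [d hd ->]; rewrite subrK.
apply: ae_0pi_mp dv => x _ [d hd E].
by rewrite -E (_ : _ - _ = d) //; ring.
Qed.

(** Entire functions, as locally uniform limits of polynomials. *)
Definition entire (F : C -> C) := forall r e : R, 0 < e ->
  exists p : {poly C}, forall l, cn l <= r -> cn (p.[l] - F l) <= e.

End Solutions.

Section Picard.
Variable R : realType.
Notation C := R[i].
Variables (sigma : R -> C) (sL2 : L2_0pi sigma) (y0 v0 : C).

Notation h := (weight sigma).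
Notation H := (weight_int sigma).

Lemma cintegrable_first (f f' g g' : R -> C) : ac_cprim f f' -> ac_cprim g g' ->
  cintegrable (fun t => f t + sigma t * g t).
Proof.
move=> pf pg; have [A HA] := ac_cprim_bounded pf; have [B HB] := ac_cprim_bounded pg.
apply: (cintegrable_dom (K := `|A| + `|B|) _ (weight_integrable sL2)).
  exact: cmeasD (ac_cprim_cmeas pf) (cmeasM (L2_cmeas sL2) (ac_cprim_cmeas pg)).
move=> x /andP[/ltW x0 /ltW xpi]; apply: (le_trans (cnD _ _)); rewrite cnM mulrDl.
have hA : cn (f x) <= `|A| by rewrite (le_trans (HA x _)) ?ler_norm ?x0.
have hB : cn (g x) <= `|B| by rewrite (le_trans (HB x _)) ?ler_norm ?x0.
apply: lerD.
  by rewrite -[leLHS]mulr1 ler_pM ?cn_ge0 ?weight_ge1.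
by rewrite mulrC ler_pM ?cn_ge0 ?cn_le_weight.
Qed.

Lemma cintegrable_second (f f' g g' k k' : R -> C) : ac_cprim f f' -> ac_cprim g g' ->
  ac_cprim k k' ->
  cintegrable (fun t => - sigma t * f t - sigma t ^+ 2 * g t - k t).
Proof.
move=> pf pg pk.
have [A HA] := ac_cprim_bounded pf; have [B HB] := ac_cprim_bounded pg.
have [D HD] := ac_cprim_bounded pk.
apply: (cintegrable_dom (K := `|A| + `|B| + `|D|) _ (weight_integrable sL2)).
  have sm := L2_cmeas sL2.
  apply: cmeasD (cmeasN (ac_cprim_cmeas pk)); apply: cmeasD (cmeasN _).
    exact: cmeasM (cmeasN sm) (ac_cprim_cmeas pf).
  exact: cmeasM (cmeasM sm sm) (ac_cprim_cmeas pg).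
move=> x /andP[/ltW x0 /ltW xpi].
apply: (le_trans (cnB _ _)); rewrite mulrDl; apply: lerD; last first.
  rewrite -[leLHS]mulr1 ler_pM ?cn_ge0 ?weight_ge1 //.
  by rewrite (le_trans (HD x _)) ?ler_norm ?x0.
apply: (le_trans (cnB _ _));
  rewrite mulrDl [cn (- _ * _)]cnM cnN [cn (_ ^+ 2 * _)]cnM cnX; apply: lerD.
  rewrite mulrC ler_pM ?cn_ge0 ?cn_le_weight //.
  by rewrite (le_trans (HA x _)) ?ler_norm ?x0.
rewrite mulrC ler_pM ?cn_ge0 ?exprn_ge0 ?cn_ge0 ?cnsq_le_weight //.
by rewrite (le_trans (HB x _)) ?ler_norm ?x0.
Qed.

(** The iterates are built as polynomials in the spectral parameter, one
    coefficient at a time, so that no polynomial dependence has to be recovered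
    from the iterated integrals. *)
Fixpoint picard n : R -> {poly C} * {poly C} :=
  if n is n'.+1 then fun x =>
    (y0%:P + \poly_(k < n'.+1)
       cintegral0 (fun t => (picard n' t).2`_k + sigma t * (picard n' t).1`_k) x,
     v0%:P + \poly_(k < n'.+1)
       cintegral0 (fun t => - sigma t * (picard n' t).2`_k - sigma t ^+ 2 * (picard n' t).1`_k
                      - ('X * (picard n' t).1)`_k) x)
  else fun=> (0, 0).

(** This bound makes the truncation of the sums in [picard] harmless. *)
Lemma picard_size n x : (size (picard n x).1 <= n)%N /\ (size (picard n x).2 <= n)%N.
Proof.
case: n => [|n]; first by rewrite /= size_poly0.
by split; apply: (leq_trans (size_polyD _ _)); rewrite geq_max size_poly andbT;
  apply: leq_trans (size_polyC_leq1 _) _.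
Qed.

Lemma picard_coef n k :
  (exists g, ac_cprim (fun x => (picard n x).1`_k) g) /\
  (exists g, ac_cprim (fun x => (picard n x).2`_k) g).
Proof.
elim: n k => [|n IH] k.
  by split; exists (fun=> 0); under [X in ac_cprim X _]funext do rewrite coef0;
    exact: ac_cprim_cst.
have [[g1 p1] [g2 p2]] := IH k.
have pX : exists g, ac_cprim (fun x => ('X * (picard n x).1)`_k) g.
  case: k {p1 p2} => [|k].
    exists (fun=> 0); have -> : (fun x => ('X * (picard n x).1)`_0) = (fun=> 0).
      by apply/funext => x; rewrite coefXM.
    exact: ac_cprim_cst.
  have [[g p] _] := IH k; exists g.
  by have -> : (fun x => ('X * (picard n x).1)`_k.+1) = (fun x => (picard n x).1`_k)
    by apply/funext => x; rewrite coefXM.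
have [g3 p3] := pX.
split.
  have p := ac_cprimD (ac_cprim_cst (y0%:P)`_k)
    (cintegral0_ac_cprim (cintegrable_first p2 p1)).
  case: (ltnP k n.+1) => kn.
    eexists; apply: (ac_cprim_ext _ p) => x _.
    by rewrite /= coefD coef_poly kn.
  exists (fun=> 0); apply: (ac_cprim_ext _ (ac_cprim_cst (y0%:P)`_k)) => x _.
  by rewrite /= coefD coef_poly ltnNge kn addr0.
have p := ac_cprimD (ac_cprim_cst (v0%:P)`_k)
  (cintegral0_ac_cprim (cintegrable_second p2 p1 p3)).
case: (ltnP k n.+1) => kn.
  eexists; apply: (ac_cprim_ext _ p) => x _.
  by rewrite /= coefD coef_poly kn.
exists (fun=> 0); apply: (ac_cprim_ext _ (ac_cprim_cst (v0%:P)`_k)) => x _.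
by rewrite /= coefD coef_poly ltnNge kn addr0.
Qed.

Section Lambda.
Variable l : C.
Let Y n x := (picard n x).1.[l].
Let V n x := (picard n x).2.[l].

(** Evaluation at a value of the parameter turns the recursion on coefficients
    into the usual Picard iteration. *)
Lemma picardS n :
  ac_cprim (Y n.+1) (fun x => V n x + sigma x * Y n x) /\
  ac_cprim (V n.+1) (fun x => - sigma x * V n x - sigma x ^+ 2 * Y n x - l * Y n x).
Proof.
have sz x := picard_size n x.
have p1 k : ac_cprim _ _ := cintegral0_ac_cprim (cintegrable_first
  (projT2 (cid (picard_coef n k).2)) (projT2 (cid (picard_coef n k).1))).
have pX k : exists g, ac_cprim (fun x => ('X * (picard n x).1)`_k) g.
  case: k => [|k].
    exists (fun=> 0); have -> : (fun x => ('X * (picard n x).1)`_0) = (fun=> 0).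
      by apply/funext => x; rewrite coefXM.
    exact: ac_cprim_cst.
  have [[g p] _] := picard_coef n k; exists g.
  by have -> : (fun x => ('X * (picard n x).1)`_k.+1) = (fun x => (picard n x).1`_k)
    by apply/funext => x; rewrite coefXM.
have p2 k : ac_cprim _ _ := cintegral0_ac_cprim (cintegrable_second
  (projT2 (cid (picard_coef n k).2)) (projT2 (cid (picard_coef n k).1)) (projT2 (cid (pX k)))).
split.
  have := ac_cprimD (ac_cprim_cst y0)
    (ac_cprim_sum (index_enum 'I_n.+1) (fun k : 'I_n.+1 => ac_cprimZ (l ^+ k) (p1 k))).
  move=> P; apply: ac_cprim_feq (ac_cprim_ext _ P) => x _.
    rewrite add0r /V /Y (horner_coef_wide l (leqW (sz x).2)) (horner_coef_wide l (leqW (sz x).1)).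
    rewrite mulr_sumr -big_split /=; apply: eq_bigr => k _; ring.
  rewrite /Y /= hornerD hornerC horner_poly; congr (_ + _); apply: eq_bigr => k _.
  by rewrite mulrC.
have := ac_cprimD (ac_cprim_cst v0)
  (ac_cprim_sum (index_enum 'I_n.+1) (fun k : 'I_n.+1 => ac_cprimZ (l ^+ k) (p2 k))).
move=> P; apply: ac_cprim_feq (ac_cprim_ext _ P) => x _.
  have szX : (size ('X * (picard n x).1)%R <= n.+1)%N.
    by rewrite (leq_trans (size_polyMleq _ _)) // size_polyX /= ltnS (sz x).1.
  have -> : l * Y n x = ('X * (picard n x).1).[l] by rewrite hornerM hornerX.
  rewrite add0r /V /Y (horner_coef_wide l (leqW (sz x).2)) (horner_coef_wide l (leqW (sz x).1)).
  rewrite (horner_coef_wide l szX) !mulr_sumr -!sumrB; apply: eq_bigr => k _; ring.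
rewrite /V /= hornerD hornerC horner_poly; congr (_ + _); apply: eq_bigr => k _.
by rewrite mulrC.
Qed.

Lemma picard_at0 n : Y n.+1 0 = y0 /\ V n.+1 0 = v0.
Proof.
by split; rewrite /Y /V /= hornerD hornerC horner_poly big1 ?addr0 // => k _;
  rewrite cintegral0_at0 mul0r.
Qed.

End Lambda.

End Picard.

(** * Convergence of the Picard iterates *)

Section PicardLimit.
Variable R : realType.
Notation C := R[i].
Variables (sigma : R -> C) (sL2 : L2_0pi sigma) (y0 v0 : C).
Notation h := (weight sigma).
Notation H := (weight_int sigma).

Section Lambda.
Variable l : C.
Let Y n x := (picard sigma y0 v0 n x).1.[l].
Let V n x := (picard sigma y0 v0 n x).2.[l].
Let Lam : R := 2 + cn l.
Let E x : R := expR (4 * Lam * H x).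
Let B : R := cn y0 + cn v0.

Let Lam2 : 2 <= Lam. Proof. by rewrite /Lam lerDl cn_ge0. Qed.
Let B0 : 0 <= B. Proof. by rewrite addr_ge0 ?cn_ge0. Qed.

Let pE (c : R) : ac_prim (fun x => c * E x) (fun x => c * (E x * (4 * Lam * h x))).
Proof.
have p1 := ac_primM (ac_prim_cst (4 * Lam)) (weight_int_ac_prim sL2).
have p2 := ac_primM (ac_prim_cst c) (ac_prim_expR p1).
apply: ac_prim_eq p2; apply: ae_0pi_all => x _; rewrite /E; ring.
Qed.

Let E_ge1 x : 0 <= x <= pi -> 1 <= E x.
Proof.
move=> xpi; rewrite -expR0 ler_expR mulr_ge0 ?weight_int_ge0 // mulr_ge0 // (le_trans _ Lam2) //.
Qed.

Let E_ge0 x : 0 <= E x. Proof. exact: expR_ge0. Qed.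

Let E_le x : 0 <= x -> x <= pi -> E x <= E pi.
Proof.
move=> x0 xp; rewrite ler_expR ler_wpM2l ?weight_int_le // mulr_ge0 // (le_trans _ Lam2) //.
Qed.

Let first_bound (dy dv : C) s x b : cn s <= h x -> cn dy <= b -> cn dv <= b ->
  cn (dv + s * dy) <= 2 * Lam * h x * b.
Proof.
move=> sh dyb dvb; apply: (le_trans (cnD _ _)); rewrite cnM.
have b0 : 0 <= b by apply: le_trans dyb; exact: cn_ge0.
have h1 : 1 <= h x by exact: weight_ge1.
have k1 : cn s * cn dy <= h x * b by rewrite ler_pM ?cn_ge0.
have k2 : b <= h x * b by rewrite ler_peMl.
have k3 : 2 * (h x * b) <=
  Lam * (h x * b) by rewrite ler_wpM2r // mulr_ge0 // (le_trans ler01).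
have : 0 <= h x * b by exact: le_trans k2.
lra.
Qed.

Let second_bound (dy dv : C) s x b : cn s <= h x -> cn s ^+ 2 <= h x -> cn dy <= b ->
  cn dv <= b ->
  cn (- s * dv - s ^+ 2 * dy - l * dy) <= 2 * Lam * h x * b.
Proof.
move=> sh s2h dyb dvb.
have b0 : 0 <= b by apply: le_trans dyb; exact: cn_ge0.
have h1 : 1 <= h x by exact: weight_ge1.
apply: (le_trans (cnB _ _)).
have := cnB (- s * dv) (s ^+ 2 * dy).
rewrite [cn (- s * dv)]cnM cnN [cn (s ^+ 2 * dy)]cnM cnX [cn (l * dy)]cnM.
have k1 : cn s * cn dv <= h x * b by rewrite ler_pM ?cn_ge0.
have k2 : cn s ^+ 2 * cn dy <= h x * b by rewrite ler_pM ?cn_ge0 ?exprn_ge0 ?cn_ge0.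
have k3 : cn l * cn dy <= cn l * (h x * b).
  by rewrite ler_wpM2l ?cn_ge0 // (le_trans dyb) // ler_peMl.
have k4 : 0 <= Lam * (h x * b) by rewrite !mulr_ge0 //;
  [apply: le_trans Lam2|apply: le_trans h1].
have k5 : Lam * (h x * b) = 2 * (h x * b) + cn l * (h x * b) by rewrite /Lam; ring.
lra.
Qed.

Let pS n : ac_cprim (Y n.+1) (fun x => V n x + sigma x * Y n x) /\
  ac_cprim (V n.+1) (fun x => - sigma x * V n x - sigma x ^+ 2 * Y n x - l * Y n x).
Proof. exact: picardS. Qed.

Let p0 n : Y n.+1 0 = y0 /\ V n.+1 0 = v0.
Proof. exact: picard_at0. Qed.

Let Y0 x : Y 0 x = 0. Proof. by rewrite /Y /= horner0. Qed.
Let V0 x : V 0 x = 0. Proof. by rewrite /V /= horner0. Qed.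

(** Measured against [E = exp(4 Lam H)], each iteration halves the distance: the
    coefficients are bounded by [Lam h], and [E] grows at the rate [4 Lam h]. *)
Lemma picard_step n x : 0 <= x <= pi ->
  cn (Y n.+1 x - Y n x) <= B / 2 ^+ n * E x /\ cn (V n.+1 x - V n x) <= B / 2 ^+ n * E x.
Proof.
clearbody Y V E; elim: n x => [|n IH] x xpi.
  have [p1 p2] := pS 0.
  have [i1 i2] := p0 0.
  have B1 : B <= B * E x by rewrite ler_peMr ?E_ge1.
  rewrite Y0 V0 !subr0 expr0 divr1; split.
    rewrite (ac_cprim_const p1 _ xpi) ?i1; first by apply: le_trans B1;
      rewrite /B lerDl cn_ge0.
    by apply: ae_0pi_all => t _; rewrite V0 Y0; ring.
  rewrite (ac_cprim_const p2 _ xpi) ?i2; first by apply: le_trans B1;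
    rewrite /B lerDr cn_ge0.
  by apply: ae_0pi_all => t _; rewrite V0 Y0; ring.
have [p1 p2] := pS n.
have [q1 q2] := pS n.+1.
have [i1 i2] := p0 n.
have [j1 j2] := p0 n.+1.
have pG := pE (B / 2 ^+ n.+1).
have q : B / 2 ^+ n = 2 * (B / 2 ^+ n.+1).
  by rewrite exprS invfM; field; rewrite expf_neq0.
have G0 : 0 <= B / 2 ^+ n.+1 * E 0.
  by rewrite !mulr_ge0 // ?invr_ge0 ?exprn_ge0.
case/andP: (xpi) => x0 xp.
split.
  have := ac_cprim_le (ac_cprimB q1 p1) pG _ (lexx 0) x0 xp.
  rewrite i1 j1 subrr subr0 => K;
    apply: (@le_trans _ _ (B / 2 ^+ n.+1 * E x - B / 2 ^+ n.+1 * E 0));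
      last by rewrite gerBl.
  apply: K; apply: ae_0pi_all => t /andP[/ltW t0 /ltW tp] _.
  have [e1 e2] := IH t (introT andP (conj t0 tp)).
  have := first_bound (cn_le_weight sigma t) e1 e2; rewrite q => K.
  have -> : V n.+1 t + sigma t * Y n.+1 t - (V n t + sigma t * Y n t) =
    V n.+1 t - V n t + sigma t * (Y n.+1 t - Y n t) by ring.
  by apply: (le_trans K); rewrite le_eqVlt; apply/orP; left; apply/eqP; ring.
have := ac_cprim_le (ac_cprimB q2 p2) pG _ (lexx 0) x0 xp.
rewrite i2 j2 subrr subr0 => K;
  apply: (@le_trans _ _ (B / 2 ^+ n.+1 * E x - B / 2 ^+ n.+1 * E 0)); last by rewrite gerBl.
apply: K; apply: ae_0pi_all => t /andP[/ltW t0 /ltW tp] _.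
have [e1 e2] := IH t (introT andP (conj t0 tp)).
have := second_bound (cn_le_weight sigma t) (cnsq_le_weight sigma t) e1 e2; rewrite q => K.
have -> : - sigma t * V n.+1 t - sigma t ^+ 2 * Y n.+1 t - l * Y n.+1 t -
   (- sigma t * V n t - sigma t ^+ 2 * Y n t - l * Y n t) =
    - sigma t * (V n.+1 t - V n t) - sigma t ^+ 2 * (Y n.+1 t - Y n t) - l * (Y n.+1 t - Y n t) by ring.
by apply: (le_trans K); rewrite le_eqVlt; apply/orP; left; apply/eqP; ring.
Qed.

Let K : R := B * E pi.

Let K0 : 0 <= K. Proof. by rewrite mulr_ge0 // E_ge0. Qed.

Let step_unif n x : 0 <= x <= pi ->
  cn (Y n.+1 x - Y n x) <= K / 2 ^+ n /\ cn (V n.+1 x - V n x) <= K / 2 ^+ n.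
Proof.
move=> xpi; have [e1 e2] := picard_step n xpi; clearbody Y V E; case/andP: xpi => x0 xp.
have k : B / 2 ^+ n * E x <= K / 2 ^+ n.
  rewrite /K [leRHS]mulrAC ler_wpM2l ?E_le //.
  by rewrite mulr_ge0 ?invr_ge0 ?exprn_ge0.
by split; apply: le_trans k.
Qed.

(** The rate of convergence depends on the parameter only through an explicit
    increasing function of its modulus, which is what makes the limits entire. *)
Theorem picard_limit : exists y v : R -> C,
  [/\ solves sigma l y v, y 0 = y0, v 0 = v0 &
    forall x n, 0 <= x <= pi ->
      cn ((picard sigma y0 v0 n x).1.[l] - y x) <=
        4 * (cn y0 + cn v0) * expR (4 * (2 + cn l) * H pi) / 2 ^+ n].
Proof.
have limY x : exists z, 0 <= x <= pi -> forall n, cn (Y n x - z) <= 4 * K / 2 ^+ n.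
  have [xpi|_] := boolP (0 <= x <= pi); last by exists 0.
  have [z Hz] := cgeometric_limit (fun n => (step_unif n xpi).1).
  by exists z.
have limV x : exists z, 0 <= x <= pi -> forall n, cn (V n x - z) <= 4 * K / 2 ^+ n.
  have [xpi|_] := boolP (0 <= x <= pi); last by exists 0.
  have [z Hz] := cgeometric_limit (fun n => (step_unif n xpi).2).
  by exists z.
have [y Hy] := boolp.choice limY; have [v Hv] := boolp.choice limV.
have K0' := K0.
have by_ x : 0 <= x <= pi -> cn (y x) <= 4 * K.
  by move=> xpi; have := Hy x xpi 0; rewrite Y0 sub0r cnN expr0 divr1.
have bv_ x : 0 <= x <= pi -> cn (v x) <= 4 * K.
  by move=> xpi; have := Hv x xpi 0; rewrite V0 sub0r cnN expr0 divr1.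
have pw n : 4 * K / 2 ^+ n <= 4 * K.
  have p2 : 1 <= 2 ^+ n :> R by rewrite exprn_ege1 // ler1n.
  by rewrite ler_pdivrMr ?exprn_gt0 // ler_peMr // mulr_ge0.
have bY n x : 0 <= x <= pi -> cn (Y n x) <= 8 * K.
  move=> xpi; rewrite -(subrK (y x) (Y n x)); apply: (le_trans (cnD _ _)).
  by have := Hy x xpi n; have := by_ x xpi; have := pw n; lra.
have bV n x : 0 <= x <= pi -> cn (V n x) <= 8 * K.
  move=> xpi; rewrite -(subrK (v x) (V n x)); apply: (le_trans (cnD _ _)).
  by have := Hv x xpi n; have := bv_ x xpi; have := pw n; lra.
(* The iterates are uniformly Lipschitz with respect to H, hence so are their
   limits; this is what makes the limits measurable. *)
pose D := 2 * Lam * (8 * K).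
have pD : ac_prim (fun x => D * H x) (fun x => D * h x).
  apply: ac_prim_eq (ac_primM (ac_prim_cst D) (weight_int_ac_prim sL2)).
  by apply: ae_0pi_all => x _; rewrite mul0r add0r.
have lip (F : nat -> R -> C) (f : R -> C) :
    (forall n a b, 0 <= a -> a <= b -> b <= pi -> cn (F n.+1 b - F n.+1 a) <=
      D * H b - D * H a) ->
    (forall x, 0 <= x <= pi -> forall n, cn (F n x - f x) <= 4 * K / 2 ^+ n) ->
    forall a b, 0 <= a -> a <= b -> b <= pi -> cn (f b - f a) <= D * H b - D * H a.
  move=> HF Hf a b a0 ab bpi; apply/ler_addgt0Pr => e e0.
  have [n Hn] := small_geometric (8 * K) e0.
  have := HF n a b a0 ab bpi.
  have Ha := Hf a (introT andP (conj a0 (le_trans ab bpi))) n.+1.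
  have Hb := Hf b (introT andP (conj (le_trans a0 ab) bpi)) n.+1.
  have -> : f b - f a = (F n.+1 b - F n.+1 a) - (F n.+1 b - f b) + (F n.+1 a - f a) by ring.
  have := cnD ((F n.+1 b - F n.+1 a) - (F n.+1 b - f b)) (F n.+1 a - f a).
  have := cnB (F n.+1 b - F n.+1 a) (F n.+1 b - f b).
  have : 2 * (4 * K / 2 ^+ n.+1) <= 8 * K / 2 ^+ n.
    have : 4 * K / 2 ^+ n.+1 <= 4 * K / 2 ^+ n.
      rewrite ler_wpM2l ?mulr_ge0 //.
      by rewrite lef_pV2 ?posrE ?exprn_gt0 // ler_eXn2l ?ltr1n.
    lra.
  lra.
have lipY a b : 0 <= a -> a <= b -> b <= pi -> cn (y b - y a) <= D * H b - D * H a.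
  apply: (lip Y) => [n {}a {}b a0 ab bpi|]; last exact: Hy.
  have [p1 _] := pS n.
  apply: (ac_cprim_le p1 pD) => //; apply: ae_0pi_all => t /andP[/ltW t0 /ltW tp] _.
  apply: (le_trans (first_bound (cn_le_weight sigma t) (bY n t _) (bV n t _)));
    rewrite ?t0 //.
  by rewrite /D le_eqVlt; apply/orP; left; apply/eqP; ring.
have lipV a b : 0 <= a -> a <= b -> b <= pi -> cn (v b - v a) <= D * H b - D * H a.
  apply: (lip V) => [n {}a {}b a0 ab bpi|]; last exact: Hv.
  have [_ p1] := pS n.
  apply: (ac_cprim_le p1 pD) => //; apply: ae_0pi_all => t /andP[/ltW t0 /ltW tp] _.
  apply: (le_trans (second_bound (cn_le_weight sigma t) (cnsq_le_weight sigma t) (bY n t _) (bV n t _))); rewrite ?t0 //.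
  by rewrite /D le_eqVlt; apply/orP; left; apply/eqP; ring.
have meas (f : R -> C) : (forall a b, 0 <= a -> a <= b -> b <= pi -> cn (f b - f a) <=
  D * H b - D * H a) ->
    cmeas f.
  move=> lipf; have acH := pD.1; split; apply: abs_cont_measurable.
    apply: (abs_cont_comb (C := 1) acH acH) => a b a0 ab bpi; rewrite mul1r.
    rewrite -ReN -ReD (le_trans (Re_le_cn _)) // (le_trans (lipf a b a0 ab bpi)) //.
    by rewrite (le_trans (ler_norm _)) // lerDl.
  apply: (abs_cont_comb (C := 1) acH acH) => a b a0 ab bpi; rewrite mul1r.
  rewrite -ImN -ImD (le_trans (Im_le_cn _)) // (le_trans (lipf a b a0 ab bpi)) //.
  by rewrite (le_trans (ler_norm _)) // lerDl.
have my := meas y lipY; have mv := meas v lipV; have ms := L2_cmeas sL2.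
pose f1 t := v t + sigma t * y t.
pose f2 t := - sigma t * v t - sigma t ^+ 2 * y t - l * y t.
have pf1 : ac_cprim (cintegral0 f1) f1.
  apply/cintegral0_ac_cprim/(cintegrable_dom (K := D) _ (weight_integrable sL2)).
    exact: cmeasD mv (cmeasM ms my).
  move=> t /andP[/ltW t0 /ltW tp].
  have tpi : 0 <= t <= pi by rewrite t0.
  have e1 : cn (y t) <= 8 * K by have := by_ t tpi; lra.
  have e2 : cn (v t) <= 8 * K by have := bv_ t tpi; lra.
  have := first_bound (cn_le_weight sigma t) e1 e2.
  by rewrite /f1 /D [_ * h t * _]mulrAC.
have pf2 : ac_cprim (cintegral0 f2) f2.
  apply/cintegral0_ac_cprim/(cintegrable_dom (K := D) _ (weight_integrable sL2)).
    apply: cmeasD (cmeasN (cmeasM (cmeas_cst l) my)).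
    apply: cmeasD (cmeasM (cmeasN ms) mv) (cmeasN (cmeasM (cmeasM ms ms) my)).
  move=> t /andP[/ltW t0 /ltW tp].
  have tpi : 0 <= t <= pi by rewrite t0.
  have e1 : cn (y t) <= 8 * K by have := by_ t tpi; lra.
  have e2 : cn (v t) <= 8 * K by have := bv_ t tpi; lra.
  have := second_bound (cn_le_weight sigma t) (cnsq_le_weight sigma t) e1 e2.
  by rewrite /f2 /D [_ * h t * _]mulrAC.
have limit_eq (F : nat -> R -> C) (f g : R -> C) (c : C) :
    ac_cprim (cintegral0 g) g ->
    (forall n, F n.+1 0 = c) ->
    (forall n, exists2 F', ac_cprim (F n.+1) F' & forall t, 0 <= t <= pi ->
        cn (F' t - g t) <= 2 * Lam * h t * (4 * K / 2 ^+ n)) ->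
    (forall x, 0 <= x <= pi -> forall n, cn (F n x - f x) <= 4 * K / 2 ^+ n) ->
    forall x, 0 <= x <= pi -> f x = c + cintegral0 g x.
  move=> pg F0 HF Hf x xpi; case/andP: (xpi) => x0 xp.
  apply/eqP; rewrite -subr_eq0 -cn_eq0 eq_le cn_ge0 andbT.
  apply/ler_addgt0Pr => e e0; rewrite add0r.
  have [n Hn] := small_geometric ((2 * Lam * H x + 1) * (4 * K)) e0.
  have [F' pF HF'] := HF n.
  pose c1 := 2 * Lam * (4 * K / 2 ^+ n).
  have pc : ac_prim (fun t => c1 * H t) (fun t => c1 * h t).
    apply: ac_prim_eq (ac_primM (ac_prim_cst c1) (weight_int_ac_prim sL2)).
    by apply: ae_0pi_all => t _; rewrite mul0r add0r.
  have := ac_cprim_le (ac_cprimB pF pg) pc _ (lexx 0) x0 xp.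
  rewrite F0 cintegral0_at0 subr0 weight_int0 mulr0 subr0 => LE.
  have {}LE : cn (F n.+1 x - cintegral0 g x - c) <= c1 * H x.
    apply: LE; apply: ae_0pi_all => t /andP[/ltW t0 /ltW tp] _.
    apply: (le_trans (HF' t _)); first by rewrite t0.
    by rewrite /c1 le_eqVlt; apply/orP; left; apply/eqP; ring.
  have H2 := Hf x xpi n.+1.
  have -> : f x - (c + cintegral0 g x) = (F n.+1 x - cintegral0 g x - c) - (F n.+1 x - f x) by ring.
  apply: (le_trans (cnB _ _)).
  have : 4 * K / 2 ^+ n.+1 <= 4 * K / 2 ^+ n.
    rewrite ler_wpM2l ?mulr_ge0 //.
    by rewrite lef_pV2 ?posrE ?exprn_gt0 // ler_eXn2l ?ltr1n.
  have E1 : (2 * Lam * H x + 1) * (4 * K) / 2 ^+ n = c1 * H x + 4 * K / 2 ^+ n.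
    by rewrite /c1; field; rewrite expf_neq0.
  move: Hn; rewrite E1; lra.
have yE x : 0 <= x <= pi -> y x = y0 + cintegral0 f1 x.
  apply: (limit_eq Y) => // [n|n]; first by have [] := p0 n.
  exists (fun x => V n x + sigma x * Y n x); first by have [] := pS n.
  move=> t tpi.
  have := first_bound (cn_le_weight sigma t) (Hy t tpi n) (Hv t tpi n).
  by rewrite /f1; have -> : V n t - v t + sigma t * (Y n t - y t) =
    V n t + sigma t * Y n t - (v t + sigma t * y t) by ring.
have vE x : 0 <= x <= pi -> v x = v0 + cintegral0 f2 x.
  apply: (limit_eq V) => // [n|n]; first by have [] := p0 n.
  exists (fun x => - sigma x * V n x - sigma x ^+ 2 * Y n x - l * Y n x);
    first by have [] := pS n.
  move=> t tpi.
  have := second_bound (cn_le_weight sigma t) (cnsq_le_weight sigma t) (Hy t tpi n) (Hv t tpi n).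
  by rewrite /f2; have ->
    : - sigma t * (V n t - v t) - sigma t ^+ 2 * (Y n t - y t) - l * (Y n t - y t) =
    - sigma t * V n t - sigma t ^+ 2 * Y n t - l * Y n t -
    (- sigma t * v t - sigma t ^+ 2 * y t - l * y t) by ring.
have o0 : 0 <= (0 : R) <= pi by rewrite lexx pi_ge0.
exists y, v; split.
- split.
    apply: ac_cprim_feq (ac_cprim_ext _ (ac_cprimD (ac_cprim_cst y0) pf1)) => t tpi.
      by rewrite add0r.
    by rewrite yE.
  apply: ac_cprim_feq (ac_cprim_ext _ (ac_cprimD (ac_cprim_cst v0) pf2)) => t tpi.
    by rewrite add0r.
  by rewrite vE.
- by rewrite yE // cintegral0_at0 addr0.
- by rewrite vE // cintegral0_at0 addr0.
- by move=> x n xpi; have := Hy x xpi n; rewrite /K /B /E /Lam mulrA.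
Qed.

End Lambda.

Theorem solution_family : exists y v : R -> C -> C,
  (forall l, [/\ solves sigma l (y ^~ l) (v ^~ l), y 0 l = y0 & v 0 l = v0]) /\
  (forall x, 0 <= x <= pi -> entire (y x)).
Proof.
have H0 l : exists yv : (R -> C) * (R -> C), [/\ solves sigma l yv.1 yv.2, yv.1 0 = y0,
  yv.2 0 = v0 &
    forall x n, 0 <= x <= pi ->
      cn ((picard sigma y0 v0 n x).1.[l] - yv.1 x) <=
        4 * (cn y0 + cn v0) * expR (4 * (2 + cn l) * H pi) / 2 ^+ n].
  by have [y [v yv]] := picard_limit l; exists (y, v).
have [f Hf] := boolp.choice H0.
exists (fun x l => (f l).1 x), (fun x l => (f l).2 x); split.
  by move=> l; have [] := Hf l.
move=> x xpi r e e0.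
have [n Hn] := small_geometric (4 * (cn y0 + cn v0) * expR (4 * (2 + r) * H pi)) e0.
exists (picard sigma y0 v0 n x).1 => l lr; have [_ _ _ Hl] := Hf l.
apply: (le_trans (Hl x n xpi)); apply: le_trans Hn.
rewrite ler_wpM2r ?invr_ge0 ?exprn_ge0 // ler_wpM2l ?mulr_ge0 ?addr_ge0 ?cn_ge0 // ler_expR.
rewrite ler_wpM2r ?weight_int_ge0 ?lexx ?pi_ge0 // ler_wpM2l // lerD2l //.
Qed.

End PicardLimit.

(** * Energy estimates *)

Section Growth.
Variable R : realType.
Notation C := R[i].
Variables (sigma : R -> C) (sL2 : L2_0pi sigma).
Notation h := (weight sigma).
Notation H := (weight_int sigma).

(** The exponential [exp(m x)], for a complex [m] and a real [x]. *)
Definition cexp (m : C) (x : R) : C :=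
  expR (complex.Re m * x) *: (cos (complex.Im m * x) +i* sin (complex.Im m * x) : Rcomplex R).

Lemma cexp_ac_cprim m : ac_cprim (cexp m) (fun x => m * cexp m x).
Proof.
have pe := ac_prim_expR (ac_prim_lin (complex.Re m)).
have pc := ac_prim_cos (ac_prim_lin (complex.Im m)).
have ps := ac_prim_sin (ac_prim_lin (complex.Im m)).
split.
  apply: eq_ac_prim (ac_primM pe pc) => x //=.
  by rewrite ReM /cexp /=; ring.
apply: eq_ac_prim (ac_primM pe ps) => x //=.
by rewrite ImM /cexp /=; ring.
Qed.

Lemma cn_cexp m x : cn (cexp m x) = expR (complex.Re m * x).
Proof.
rewrite /cexp /= !exprMn -mulrDr cos2Dsin2 mulr1 sqrtr_sqr ger0_norm //.
Qed.

Variables (m : C) (y v : R -> C).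
Hypothesis yv : solves sigma (- m ^+ 2) y v.
Hypothesis m1 : 1 <= cn m.
Hypothesis k0 : 0 <= complex.Re m.

Let k := complex.Re m.
(** For [sigma = 0] the two components are multiples of [exp(- m x)] and
    [exp(m x)]; the potential couples them through [sigma] and [sigma^2 y], and the
    latter is smaller by a factor [m]. *)
Definition down_wave x := m * y x - v x.
Definition up_wave x := m * y x + v x.

Lemma down_wave_ac_cprim : ac_cprim down_wave (fun x => - m * down_wave x + (sigma x * up_wave x + sigma x ^+ 2 * y x)).
Proof.
by have [py pv] := yv; apply: ac_cprim_feq (ac_cprimB (ac_cprimZ m py) pv) => x _;
  rewrite /down_wave /up_wave; ring.
Qed.

Lemma up_wave_ac_cprim : ac_cprim up_wave (fun x => m * up_wave x + (sigma x * down_wave x - sigma x ^+ 2 * y x)).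
Proof.
by have [py pv] := yv; apply: ac_cprim_feq (ac_cprimD (ac_cprimZ m py) pv) => x _;
  rewrite /down_wave /up_wave; ring.
Qed.

Definition wave_size x := cn (down_wave x) + cn (up_wave x).

Lemma wave_sum x : cn (down_wave x + up_wave x) = 2 * cn m * cn (y x).
Proof.
rewrite (_ : down_wave x + up_wave x = (2%:R : R)%:C * (m * y x)).
  by rewrite cnM cn_real normr_nat cnM mulrA.
by rewrite /down_wave /up_wave rmorph_nat; ring.
Qed.

Lemma y_le_wave_size x : 2 * cn m * cn (y x) <= wave_size x.
Proof. by rewrite -wave_sum cnD. Qed.

Let E x := cn (down_wave x) ^+ 2 + cn (up_wave x) ^+ 2.

Let Re_bound (a q : C) : `|complex.Re (a^*%C * q)| <= cn a * cn q.
Proof.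
rewrite (le_trans (Re_le_cn _)) // cnM.
by have -> : cn a^*%C = cn a by case: a => ? ? /=; rewrite sqrrN.
Qed.

Let ReJ (a : C) : complex.Re (a^*%C * (m * a)) = k * cn a ^+ 2.
Proof. by rewrite cn_sq /k; case: a m => [a1 a2] [b1 b2] /=; ring. Qed.

(** The free motion changes [|a|^2 + |b|^2] at a rate at most [2 k], and the
    coupling at a rate at most [4 h]; the bound on [y] absorbs [sigma^2 y]. *)
Let energy_bound (a b yx s : C) (hx : R) : cn s <= hx -> cn s ^+ 2 <= hx -> 1 <= hx ->
  2 * cn yx <= cn a + cn b ->
  `|2 * complex.Re (a^*%C * (- m * a + (s * b + s ^+ 2 * yx))) +
    2 * complex.Re (b^*%C * (m * b + (s * a - s ^+ 2 * yx)))| <=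
  (2 * k + 4 * hx) * (cn a ^+ 2 + cn b ^+ 2).
Proof.
move=> sh s2h h1 yb.
have n1 : cn (s * b + s ^+ 2 * yx) <= hx * (cn b + cn yx).
  apply: (le_trans (cnD _ _));
    rewrite [cn (s * b)]cnM [cn (s ^+ 2 * _)]cnM cnX [leRHS]mulrDr.
  by apply: lerD; rewrite ler_wpM2r ?cn_ge0.
have n2 : cn (s * a - s ^+ 2 * yx) <= hx * (cn a + cn yx).
  apply: (le_trans (cnB _ _));
    rewrite [cn (s * a)]cnM [cn (s ^+ 2 * _)]cnM cnX [leRHS]mulrDr.
  by apply: lerD; rewrite ler_wpM2r ?cn_ge0.
have q1 := Re_bound a (s * b + s ^+ 2 * yx).
have q2 := Re_bound b (s * a - s ^+ 2 * yx).
move: (s * b + s ^+ 2 * yx) (s * a - s ^+ 2 * yx) n1 n2 q1 q2 => u1 u2 n1 n2 q1 q2.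
rewrite [a^*%C * _]mulrDr [b^*%C * _]mulrDr !ReD mulNr mulrN ReN !ReJ.
have [a0 b0] : 0 <= cn a /\ 0 <= cn b by rewrite !cn_ge0.
have Y0 : 0 <= cn yx by exact: cn_ge0.
have t1 : cn a * cn u1 <= hx * (cn a * (cn b + cn yx)).
  by rewrite mulrCA ler_wpM2l.
have t2 : cn b * cn u2 <= hx * (cn b * (cn a + cn yx)).
  by rewrite mulrCA ler_wpM2l.
have t3 : cn a * (cn b + cn yx) + cn b * (cn a + cn yx) <= 2 * (cn a ^+ 2 + cn b ^+ 2).
  by have := sqr_ge0 (cn a - cn b); nra.
have t4 : hx * (cn a * (cn b + cn yx)) + hx * (cn b * (cn a + cn yx)) <=
  hx * (2 * (cn a ^+ 2 + cn b ^+ 2)).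
  by rewrite -mulrDr ler_wpM2l // (le_trans ler01).
have ka : 0 <= k * cn a ^+ 2 by rewrite mulr_ge0 ?sqr_ge0.
have kb : 0 <= k * cn b ^+ 2 by rewrite mulr_ge0 ?sqr_ge0.
move: q1 q2; rewrite !ler_norml; lra.
Qed.

Let E_ac_prim : exists2 E', ac_prim E E' & forall x, `|E' x| <= (2 * k + 4 * h x) * E x.
Proof.
eexists; first exact: ac_primD (ac_cprim_sqnorm down_wave_ac_cprim) (ac_cprim_sqnorm up_wave_ac_cprim).
move=> x; apply: energy_bound;
  [exact: cn_le_weight|exact: cnsq_le_weight|exact: weight_ge1|].
by apply: le_trans (y_le_wave_size x);
  rewrite mulrAC -[leLHS]mulr1 ler_wpM2l // mulr_ge0 ?cn_ge0.
Qed.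

(* The factor 2 in front pays for passing between the sum of the moduli and the
   square root of the sum of their squares. *)
Let size_of_energy x z u w : E x <= E z * expR w -> w <= 2 * u + 4 * H pi ->
  wave_size x <= 2 * expR (2 * H pi) * wave_size z * expR u.
Proof.
move=> K wu.
have S2 : wave_size x ^+ 2 <= 2 * E x by rewrite /wave_size /E; have :=
  sqr_ge0 (cn (down_wave x) - cn (up_wave x)); nra.
have S0 : E z <= wave_size z ^+ 2.
  by rewrite /wave_size /E; have := cn_ge0 (down_wave z); have := cn_ge0 (up_wave z); nra.
have r0 : 0 <= 2 * expR (2 * H pi) * wave_size z * expR u.
  by rewrite !mulr_ge0 ?expR_ge0 // addr_ge0 ?cn_ge0.
rewrite -(ler_pXn2r (_ : 0 < 2)%N) ?nnegrE ?addr_ge0 ?cn_ge0 //.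
have e1 : expR w <= expR u ^+ 2 * expR (2 * H pi) ^+ 2.
  by rewrite -!expRM_natl -expRD ler_expR; lra.
have e2 : E z * expR w <= wave_size z ^+ 2 * (expR u ^+ 2 * expR (2 * H pi) ^+ 2).
  by rewrite ler_pM ?expR_ge0 // addr_ge0 ?sqr_ge0.
have -> : (2 * expR (2 * H pi) * wave_size z * expR u) ^+ 2 =
  4 * (wave_size z ^+ 2 * (expR u ^+ 2 * expR (2 * H pi) ^+ 2)) by ring.
have : 0 <= wave_size z ^+ 2 * (expR u ^+ 2 * expR (2 * H pi) ^+ 2).
  by rewrite mulr_ge0 ?sqr_ge0 // mulr_ge0 ?sqr_ge0.
lra.
Qed.

(** Multiplied by [exp(- 2 k x - 4 H x)], the energy is nonincreasing. *)
Lemma growth_forward x : 0 <= x <= pi ->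
  wave_size x <= 2 * expR (2 * H pi) * wave_size 0 * expR (k * x).
Proof.
move=> xpi; have [x0 xp] := andP xpi; have [E' pE HE'] := E_ac_prim.
have pw := ac_primD (ac_prim_lin (- (2 * k))) (ac_primM (ac_prim_cst (- 4)) (weight_int_ac_prim sL2)).
have := @ac_prim_nonincreasing R _ _ 0 x (ac_primM pE (ac_prim_expR pw)) _ (lexx 0) x0 xp.
rewrite weight_int0 !mulr0 addr0 expR0 mulr1 => K.
apply: (size_of_energy (w := 2 * k * x + 4 * H x)); last first.
  by have := weight_int_le sL2 x0 xp (lexx _); lra.
rewrite -ler_pdivrMr ?expR_gt0 // -expRN.
have -> : - (2 * k * x + 4 * H x) = - (2 * k) * x + - 4 * H x by ring.
apply: K; apply: ae_0pi_all => t _ _.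
have := HE' t; rewrite ler_norml => /andP[_ e1].
rewrite (_ : _ + _ = (E' t - (2 * k + 4 * h t) * E t) * expR (- (2 * k) * t + - 4 * H t)); last by ring.
by rewrite mulr_le0_ge0 ?expR_ge0 // subr_le0.
Qed.

(** Multiplied by [exp(2 k x + 4 H x)], the energy is nondecreasing. *)
Lemma growth_backward x : 0 <= x <= pi ->
  wave_size x <= 2 * expR (2 * H pi) * wave_size pi * expR (k * (pi - x)).
Proof.
move=> xpi; have [x0 xp] := andP xpi; have [E' pE HE'] := E_ac_prim.
have pw := ac_primD (ac_prim_lin (2 * k)) (ac_primM (ac_prim_cst 4) (weight_int_ac_prim sL2)).
have K := @ac_prim_nonincreasing R _ _ x pi (ac_primN (ac_primM pE (ac_prim_expR pw))) _ x0 xp (lexx _).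
apply: (size_of_energy (w := 2 * k * pi + 4 * H pi - (2 * k * x + 4 * H x))); last first.
  by have := weight_int_ge0 sL2 xpi; lra.
rewrite expRD expRN mulrA ler_pdivlMr ?expR_gt0 // -lerN2.
apply: K; apply: ae_0pi_all => t _ _.
have := HE' t; rewrite ler_norml => /andP[e1 _].
rewrite (_ : - (_ + _) = (- E' t - (2 * k + 4 * h t) * E t) * expR (2 * k * t + 4 * H t)); last by ring.
by rewrite mulr_le0_ge0 ?expR_ge0 // subr_le0; lra.
Qed.

End Growth.

(** * Solutions that decay away from the left endpoint *)

Section Decay.
Variable R : realType.
Notation C := R[i].
Variables (sigma : R -> C) (sL2 : L2_0pi sigma).
Notation h := (weight sigma).
Notation H := (weight_int sigma).

Section Fixed.
Variables (m : C) (y v : R -> C).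
Hypothesis yv : solves sigma (- m ^+ 2) y v.
Let k := complex.Re m.
Hypothesis k1 : 1 <= k.
Variable d : R.
Hypothesis d0 : 0 < d.

Notation a := (down_wave m y v).
Notation b := (up_wave m y v).
Notation S := (wave_size m y v).
Let N := S pi.
Let G : R := 2 * expR (2 * H pi).

Let km : k <= cn m.
Proof. by apply: le_trans (Re_le_cn m); exact: ler_norm. Qed.
Let m1 : 1 <= cn m. Proof. exact: le_trans km. Qed.
Let k0 : 0 <= k. Proof. exact: le_trans k1. Qed.
Let kp : 0 < k. Proof. exact: lt_le_trans k1. Qed.
Let N0 : 0 <= N. Proof. by rewrite addr_ge0 ?cn_ge0. Qed.
Let G0 : 0 <= G. Proof. by rewrite mulr_ge0 ?expR_ge0. Qed.

Let bwd x : 0 <= x <= pi -> S x <= G * N * expR (k * (pi - x)).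
Proof. exact: growth_backward. Qed.

Let y_bound x : 0 <= x <= pi -> cn (y x) <= G * N * expR (k * (pi - x)) / k.
Proof.
move=> xpi; rewrite ler_pdivlMr //; apply: le_trans (bwd xpi).
apply: le_trans (y_le_wave_size m y v x); rewrite mulrC; apply: ler_wpM2r;
  first exact: cn_ge0.
by have := km; have := cn_ge0 m; lra.
Qed.

(* Splitting a product between the weight and a squared exponential; d will be
   small and t an exponential whose square has a small integral. *)
Let amgm (t c hx : R) : c ^+ 2 <= hx -> t * c <= d * hx + t ^+ 2 / d.
Proof.
move=> ch; rewrite -(ler_pM2r d0) mulrDl divfK ?gt_eqF //.
have : d * d * c ^+ 2 <= d * d * hx by rewrite ler_wpM2l // mulr_ge0 // ltW.
have := sqr_ge0 (d * c - t); have := sqr_ge0 (d * c); have := sqr_ge0 t; nra.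
Qed.

Let rate (c1 c2 s0 c : R) (ke : R) : ke != 0 ->
  ac_prim (fun s => c * (c1 * H s + c2 * expR (ke * s + s0) / ke))
        (fun s => c * (c1 * h s + c2 * expR (ke * s + s0))).
Proof.
move=> ke0.
have pexp := ac_prim_expR (ac_primD (ac_prim_lin ke) (ac_prim_cst s0)).
have p1 := ac_primM (ac_prim_cst c1) (weight_int_ac_prim sL2).
have p2 := ac_primM (ac_prim_cst (c2 / ke)) pexp.
have p3 := ac_primM (ac_prim_cst c) (ac_primD p1 p2).
have -> : (fun s => c * (c1 * H s + c2 * expR (ke * s + s0) / ke)) =
          (fun s => c * (c1 * H s + c2 / ke * expR (ke * s + s0))).
  by apply/funext => s; rewrite [c2 / ke * _]mulrAC.
by apply: ac_prim_eq p3; apply: ae_0pi_all => s _; field.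
Qed.

(** Relative sizes of the perturbations in the next two lemmas. Both tend to [0]
    when [d] does, provided that [1 / (k d)] does too. *)
Definition up_error : R := (d + k^-1) * H pi + (4 * k * d)^-1.
Definition down_error : R := (d + G * up_error + G / k) * H pi + (4 * k * d)^-1.

Let kd0 : 0 < 4 * k * d. Proof. by rewrite !mulr_gt0. Qed.
Let Hpi0 : 0 <= H pi. Proof. by rewrite weight_int_ge0 // lexx pi_ge0. Qed.

Let up_error_ge0 : 0 <= up_error.
Proof.
rewrite addr_ge0 ?invr_ge0 ?(ltW kd0) // mulr_ge0 // addr_ge0 ?invr_ge0 // ltW //.
Qed.

(** Integrate [(b exp(- m x))'] from [x] to [pi]. The energy bound controls the
    right-hand side, and the factor [exp(- 2 k (t - x))] that is left makes its
    integral small, because [sigma] is square integrable. *)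
Lemma up_wave_small x : 0 <= x <= pi ->
  cn (b x) <= N * expR (- (k * (pi - x))) + G * N * up_error * expR (k * (pi - x)).
Proof.
move=> xpi; have [x0 xp] := andP xpi.
pose P := G * N * expR (k * pi - 2 * k * x).
have P0 : 0 <= P by rewrite !mulr_ge0 ?expR_ge0.
have ke0 : - (4 * k) != 0 by rewrite oppr_eq0 mulf_neq0 // gt_eqF.
have pG := rate (d + k^-1) d^-1 (4 * k * x) P ke0.
have pf := ac_cprimM (up_wave_ac_cprim yv) (cexp_ac_cprim (- m)).
have := ac_cprim_le pf pG _ x0 xp (lexx _).
have cE t : cn (cexp (- m) t) = expR (- (k * t)) by rewrite cn_cexp ReN mulNr.
move=> K.
have {}K : cn (b pi * cexp (- m) pi - b x * cexp (- m) x) <= P * up_error.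
  apply: le_trans (K _) _; last first.
    rewrite -mulrBr ler_wpM2l // /up_error.
    have e1 : expR (- (4 * k) * x + 4 * k * x) = 1 by rewrite mulNr addNr expR0.
    rewrite e1 mulr1.
    have q : d^-1 / - (4 * k) = - (4 * k * d)^-1 by rewrite invrN mulrN -invfM mulrC.
    rewrite q [_ * expR _ / _]mulrAC q.
    have : 0 <= (4 * k * d)^-1 * expR (- (4 * k) * pi + 4 * k * x).
      by rewrite mulr_ge0 ?expR_ge0 ?invr_ge0 ?(ltW kd0).
    have : 0 <= (d + k^-1) * H x by rewrite mulr_ge0 ?weight_int_ge0 // addr_ge0 ?invr_ge0 // ltW.
    lra.
  apply: ae_0pi_all => t /andP[/ltW t0 /ltW tp] /andP[/ltW xt _].
  have tpi : 0 <= t <= pi by rewrite t0.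
  have -> : (m * b t + (sigma t * a t - sigma t ^+ 2 * y t)) * cexp (- m) t + b t * (- m * cexp (- m) t)
     = (sigma t * a t - sigma t ^+ 2 * y t) * cexp (- m) t by ring.
  rewrite cnM cE.
  have at_ : cn (a t) <= G * N * expR (k * (pi - t)).
    by apply: le_trans (bwd tpi); rewrite /wave_size lerDl cn_ge0.
  have n1 : cn (sigma t * a t - sigma t ^+ 2 * y t) <=
    (cn (sigma t) + h t / k) * (G * N * expR (k * (pi - t))).
    apply: (le_trans (cnB _ _));
      rewrite [cn (_ * a t)]cnM [cn (_ ^+ 2 * _)]cnM cnX [leRHS]mulrDl.
    apply: lerD; first by rewrite ler_wpM2l ?cn_ge0.
    have -> : h t / k * (G * N * expR (k * (pi - t))) = h t * (G * N * expR (k * (pi - t)) / k) by ring.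
    by rewrite ler_pM ?exprn_ge0 ?cn_ge0 ?cnsq_le_weight ?y_bound.
  apply: (le_trans (ler_wpM2r (expR_ge0 _) n1)).
  pose tt := expR (- (2 * k * (t - x))).
  have tt1 : tt <= 1 by rewrite -expR0 ler_expR oppr_le0 mulr_ge0 ?mulr_ge0 // subr_ge0.
  have -> : (cn (sigma t) + h t / k) * (G * N * expR (k * (pi - t))) * expR (- (k * t)) =
      P * (tt * cn (sigma t) + tt * (h t / k)).
    rewrite /P /tt.
    have : expR (- (2 * k * (t - x))) * expR (2 * k * (t - x)) = 1 by rewrite -expRD addNr expR0.
    have -> : expR (k * pi - 2 * k * x) = expR (k * (pi - t)) * expR (- (k * t)) * expR (2 * k * (t - x)).
      by rewrite -!expRD; congr expR; ring.
    move: (expR (- (2 * k * (t - x)))) (expR (2 * k * (t - x))) => u w uw.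
    transitivity ((cn (sigma t) + h t / k) * (G * N * expR (k * (pi - t))) * expR (- (k * t)) * (u * w)); last by ring.
    by rewrite uw mulr1.
  rewrite ler_wpM2l //.
  have := amgm tt (cnsq_le_weight sigma t).
  have -> : tt ^+ 2 / d = d^-1 * expR (- (4 * k) * t + 4 * k * x).
    by rewrite /tt -expRM_natl mulrC; congr (_ * expR _); ring.
  have : tt * (h t / k) <= k^-1 * h t.
    by rewrite mulrC -[leRHS]mulr1 [k^-1 * _]mulrC ler_wpM2l // divr_ge0 // (le_trans ler01 (weight_ge1 _ _)).
  lra.
have : cn (b x * cexp (- m) x) <= cn (b pi * cexp (- m) pi) + P * up_error.
  have -> : b x * cexp (- m) x = b pi * cexp (- m) pi - (b pi * cexp (- m) pi - b x * cexp (- m) x) by ring.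
  by apply: (le_trans (cnB _ _)); rewrite lerD2l.
rewrite !cnM !cE => L.
have bN : cn (b pi) <= N by rewrite /N /wave_size lerDr cn_ge0.
have ex : expR (- (k * x)) * expR (k * x) = 1 by rewrite -expRD addNr expR0.
have -> : cn (b x) = cn (b x) * expR (- (k * x)) * expR (k * x) by rewrite -mulrA ex mulr1.
apply: (le_trans (ler_wpM2r (expR_ge0 _) L)); rewrite mulrDl; apply: lerD.
  rewrite -mulrA -expRD.
  have -> : - (k * pi) + k * x = - (k * (pi - x)) by ring.
  by rewrite ler_wpM2r ?expR_ge0.
rewrite /P le_eqVlt; apply/orP; left; apply/eqP.
have -> : expR (k * (pi - x)) = expR (k * pi - 2 * k * x) * expR (k * x) by rewrite -expRD; congr expR; ring.
ring.
Qed.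

(** Integrate [(a exp(m x))'] over the whole interval, with [up_wave_small] for the
    other component. The plain energy bound would only give an error comparable to
    the main term. *)
Lemma down_wave_large : expR (k * pi) * (cn (a pi) - N * down_error) <= cn (a 0).
Proof.
pose P := N * expR (k * pi).
have P0 : 0 <= P by rewrite mulr_ge0 ?expR_ge0.
have ke0 : 4 * k != 0 by rewrite mulf_neq0 // gt_eqF.
have pG := rate (d + G * up_error + G / k) d^-1 (- (4 * k * pi)) P ke0.
have pf := ac_cprimM (down_wave_ac_cprim yv) (cexp_ac_cprim m).
have := ac_cprim_le pf pG _ (lexx 0) (pi_ge0 R) (lexx _).
have cE t : cn (cexp m t) = expR (k * t) by rewrite cn_cexp.
have c0 : cexp m 0 = 1.
  by rewrite /cexp !mulr0 expR0 cos0 sin0 scale1r.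
have cc0 : 0 <= d + G * up_error + G / k by rewrite !addr_ge0 ?divr_ge0 ?mulr_ge0 // ltW.
move=> K.
have {}K : cn (a pi * cexp m pi - a 0 * cexp m 0) <= P * down_error.
  apply: le_trans (K _) _; last first.
    rewrite -mulrBr ler_wpM2l // /down_error weight_int0 !mulr0 !add0r addrN expR0 mulr1.
    have q : d^-1 / (4 * k) = (4 * k * d)^-1 by rewrite -invfM mulrC.
    rewrite q [_ * expR _ / _]mulrAC q.
    have : 0 <= (4 * k * d)^-1 * expR (- (4 * k * pi)).
      by rewrite mulr_ge0 ?expR_ge0 ?invr_ge0 ?(ltW kd0).
    lra.
  apply: ae_0pi_all => t /andP[/ltW t0 /ltW tp] _.
  have tpi : 0 <= t <= pi by rewrite t0.
  have -> : (- m * a t + (sigma t * b t + sigma t ^+ 2 * y t)) * cexp m t + a t * (m * cexp m t)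
     = (sigma t * b t + sigma t ^+ 2 * y t) * cexp m t by ring.
  rewrite cnM cE.
  pose F := N * expR (- (k * (pi - t))) + G * N * up_error * expR (k * (pi - t)).
  have n1 : cn (sigma t * b t + sigma t ^+ 2 * y t) <=
    cn (sigma t) * F + h t * (G * N * expR (k * (pi - t)) / k).
    apply: (le_trans (cnD _ _)); rewrite [cn (_ * b t)]cnM [cn (_ ^+ 2 * _)]cnM cnX.
    apply: lerD; first by rewrite ler_wpM2l ?cn_ge0 // up_wave_small.
    by rewrite ler_pM ?exprn_ge0 ?cn_ge0 ?cnsq_le_weight ?y_bound.
  apply: (le_trans (ler_wpM2r (expR_ge0 _) n1)).
  pose tt := expR (- (2 * k * (pi - t))).
  have -> : (cn (sigma t) * F + h t * (G * N * expR (k * (pi - t)) / k)) * expR (k * t) =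
      P * (tt * cn (sigma t) + G * up_error * cn (sigma t) + G / k * h t).
    have e1 : expR (k * pi) = expR (k * (pi - t)) * expR (k * t) by rewrite -expRD;
      congr expR; ring.
    have e2 : expR (- (k * (pi - t))) = expR (k * (pi - t)) * tt by rewrite -expRD;
      congr expR; ring.
    rewrite /F /P e1 e2; ring.
  rewrite ler_wpM2l //.
  have := amgm tt (cnsq_le_weight sigma t).
  have -> : tt ^+ 2 / d = d^-1 * expR (4 * k * t + - (4 * k * pi)).
    by rewrite /tt -expRM_natl mulrC; congr (_ * expR _); ring.
  have : G * up_error * cn (sigma t) <= G * up_error * h t.
    by rewrite ler_wpM2l ?cn_le_weight // mulr_ge0.
  lra.
have : cn (a pi * cexp m pi) <= cn (a 0 * cexp m 0) + P * down_error.
  have -> : a pi * cexp m pi = a 0 * cexp m 0 + (a pi * cexp m pi - a 0 * cexp m 0) by ring.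
  by apply: (le_trans (cnD _ _)); rewrite lerD2l.
rewrite c0 mulr1 cnM cE /P; lra.
Qed.

End Fixed.

End Decay.
Section DecayThm.
Variable R : realType.
Notation C := R[i].
Variables (sigma : R -> C) (sL2 : L2_0pi sigma).
Notation H := (weight_int sigma).

Theorem growth : exists2 K : R, 1 <= K & forall (m : C) (y v : R -> C),
  solves sigma (- m ^+ 2) y v -> 1 <= cn m -> 0 <= complex.Re m ->
  forall x, 0 <= x <= pi ->
    cn m * cn (y x) <= K * (cn m * cn (y 0) + cn (v 0)) * expR (complex.Re m * x).
Proof.
exists (2 * expR (2 * H pi)).
  have : 1 <= expR (2 * H pi) by rewrite -expR0 ler_expR mulr_ge0 ?weight_int_ge0 ?lexx ?pi_ge0.
  lra.
move=> m y v yv m1 k0 x xpi.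
have := growth_forward sL2 yv m1 k0 xpi.
have e0 : 0 <= 2 * expR (2 * H pi) * expR (complex.Re m * x) by rewrite !mulr_ge0 ?expR_ge0.
have s0 : wave_size m y v 0 <= 2 * (cn m * cn (y 0) + cn (v 0)).
  rewrite /wave_size /down_wave /up_wave; have := cnB (m * y 0) (v 0); have :=
    cnD (m * y 0) (v 0).
  rewrite cnM; lra.
have := y_le_wave_size m y v x; have := ler_wpM2l e0 s0.
move: (expR (2 * H pi)) (expR (complex.Re m * x)) => g e; lra.
Qed.

(** If the decaying component is not small at [pi], then at [0] it dominates the
    growing one and has the full size [exp(k pi)]. Hence the energy bound from the
    right, [exp(k (pi - x))], is at most a multiple of [exp(- k x) |y(0)|]. *)
Theorem decay : exists2 K : R, 1 <= K & forall (m : C) (y v : R -> C),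
  solves sigma (- m ^+ 2) y v -> K <= complex.Re m ->
  wave_size m y v pi <= 4 * cn (down_wave m y v pi) -> 0 < wave_size m y v pi ->
  [/\ 4 * cn (up_wave m y v 0) <= cn (down_wave m y v 0), 0 < cn (down_wave m y v 0) &
    forall x, 0 <= x <= pi -> cn (y x) <= K * cn (y 0) * expR (- (complex.Re m * x))].
Proof.
pose B := H pi; pose G := 2 * expR (2 * H pi).
have B0 : 0 <= B by rewrite weight_int_ge0 // lexx pi_ge0.
have G2 : 2 <= G.
  have : 1 <= expR (2 * H pi) by rewrite -expR0 ler_expR mulr_ge0.
  rewrite /G; lra.
pose Z := G * ((2 * B + 3) * (B + 1)).
have Z6 : 6 <= Z.
  have : 3 <= (2 * B + 3) * (B + 1) by nra.
  by rewrite /Z; move: (_ * _) => w; nra.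
pose T := 64 * Z.
have T0 : 0 < T by rewrite /T; lra.
(* With k >= T^2 = 1 / d^2, both 1 / k and 1 / (4 k d) are at most d, and then
   G up_error and down_error are at most d Z = 1 / 64. *)
pose d := T^-1.
have d0 : 0 < d by rewrite invr_gt0.
have dZ : d * Z = 64^-1 by rewrite /d /T; field; lra.
have T2 : T <= T ^+ 2 by rewrite expr2 ler_peMr // ?(ltW T0) // /T; lra.
(* The constant 6 G comes from bounding the full size by 64/15 times the decaying
   component, and the latter by 4/3 of 2 m y at 0. *)
exists (T ^+ 2 + 6 * G); first by rewrite /T in T2 *; lra.
move=> m y v yv; set k := complex.Re m => Kk aS S0.
have kT : T ^+ 2 <= k by lra.
have kT1 : T <= k by exact: le_trans kT.
have k1 : 1 <= k by rewrite /T in kT1; lra.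
have k0 : 0 < k by lra.
have kd : k^-1 <= d by rewrite /d lef_pV2.
have kd4 : (4 * k * d)^-1 <= d.
  have -> : (4 * k * d)^-1 = T / (4 * k) by rewrite /d; field; rewrite !gt_eqF.
  rewrite ler_pdivrMr ?mulr_gt0 //.
  have : d * T ^+ 2 <= d * (4 * k) by rewrite ler_wpM2l ?(ltW d0) //; lra.
  by rewrite expr2 mulrA /d mulVf ?gt_eqF // mul1r.
have kmn : k <= cn m by apply: le_trans (Re_le_cn m); exact: ler_norm.
have m0 : 0 < cn m by lra.
pose N := wave_size m y v pi.
pose e1 := up_error sigma m d; pose e2 := down_error sigma m d.
have e1b : e1 <= d * (2 * B + 1).
  have : (d + k^-1) * B <= (d + d) * B by rewrite ler_wpM2r // lerD2l.
  rewrite /e1 /up_error -/k -/B; lra.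
have Ge1 : G * e1 <= G * (d * (2 * B + 1)) by rewrite ler_wpM2l //; lra.
have Ge1' : G * e1 <= 64^-1.
  apply: (le_trans Ge1); rewrite -dZ /Z mulrCA ler_wpM2l ?(ltW d0) //.
  rewrite ler_wpM2l //; first by lra.
  nra.
have e2b : e2 <= 64^-1.
  have : (d + G * e1 + G / k) * B <= (d + G * (d * (2 * B + 1)) + G * d) * B.
    rewrite ler_wpM2r // lerD // ?lerD2l // ler_wpM2l //; lra.
  have : d * ((1 + G * (2 * B + 1) + G) * B + 1) <= d * Z.
    rewrite ler_wpM2l ?(ltW d0) // /Z; nra.
  rewrite -dZ /e2 /down_error -/k -/B -/G -/e1; lra.
have := down_wave_large sL2 yv k1 d0; rewrite -/k -/e2 -/N => L.
have o0 : 0 <= (0 : R) <= pi by rewrite lexx pi_ge0.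
have := up_wave_small sL2 yv k1 d0 o0; rewrite -/k -/e1 -/N -/G subr0 => U.
have ex : expR (- (k * pi)) <= 64^-1 * expR (k * pi).
  have k64 : 64 <= k by rewrite /T in kT1; lra.
  have p1 : 1 <= pi :> R by have := pi_ge2 R; lra.
  have kp : 64 <= k * pi.
    have : 64 * 1 <= k * pi by rewrite ler_pM.
    lra.
  have := expR_ge1Dx (k * pi); have := expR_gt0 (k * pi).
  rewrite expRN; move: (expR (k * pi)) => q q0 q1.
  have q64 : 64 <= q by lra.
  have qi : q^-1 <= 64^-1 by rewrite lef_pV2 // posrE.
  apply: (le_trans qi); lra.
have ep : 0 < expR (k * pi) by exact: expR_gt0.
have N0 : 0 < N by [].
pose Q := N * expR (k * pi).
have Q0 : 0 < Q by rewrite mulr_gt0.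
have L' : 15 / 64 * Q <= cn (down_wave m y v 0).
  apply: le_trans L; rewrite /Q mulrA [leRHS]mulrC ler_wpM2r ?(ltW ep) //.
  have : N * e2 <= N * 64^-1 by rewrite ler_wpM2l // ltW.
  rewrite -/N in aS; lra.
have U' : cn (up_wave m y v 0) <= 2 / 64 * Q.
  apply: (le_trans U).
  have : N * expR (- (k * pi)) <= N * (64^-1 * expR (k * pi)) by rewrite ler_wpM2l // ltW.
  have : G * e1 * Q <= 64^-1 * Q by rewrite ler_wpM2r // ltW.
  rewrite /Q; lra.
have ba : 4 * cn (up_wave m y v 0) <= cn (down_wave m y v 0) by lra.
split => //; first by lra.
move=> x xpi.
have := growth_backward sL2 yv (le_trans k1 kmn) (ltW k0) xpi; rewrite -/k -/N -/G => gb.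
have := y_le_wave_size m y v x => yx.
have y0 : 3 / 4 * cn (down_wave m y v 0) <= 2 * cn m * cn (y 0).
  rewrite -(wave_sum m y v 0).
  have := cnB (down_wave m y v 0 + up_wave m y v 0) (up_wave m y v 0); rewrite addrK; lra.
have gbE : G * N * expR (k * (pi - x)) = G * Q * expR (- (k * x)).
  by rewrite /Q mulrBr expRD; ring.
rewrite gbE in gb.
have QY : Q <= 6 * (2 * cn m * cn (y 0)) by lra.
have w0 : 0 <= G * expR (- (k * x)) by rewrite mulr_ge0 ?expR_ge0 //; lra.
have := ler_wpM2l w0 QY => F1.
have cm2 : 0 < 2 * cn m by lra.
rewrite -(ler_pM2l cm2); apply: (le_trans yx); apply: (le_trans gb).
have w1 : 0 <= T ^+ 2 * (2 * cn m * cn (y 0) * expR (- (k * x))).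
  apply: mulr_ge0; first exact: sqr_ge0.
  by rewrite mulr_ge0 ?expR_ge0 // mulr_ge0 ?cn_ge0 // ltW.
clear -F1 w1.
move: F1 w1; move: (expR (- (k * x))) => u; lra.
Qed.

End DecayThm.

(** * Entire functions and polynomials for a large parameter *)

Section Liouville.
Variable R : realType.
Notation C := R[i].
Implicit Types (p q : {poly C}) (F G : C -> C).

Lemma cn_horner_bounded p (r : R) : exists M, forall z, cn z <= r -> cn p.[z] <= M.
Proof.
elim/poly_ind: p => [|p c [M HM]]; first by exists 0 => z _; rewrite horner0 cn0.
exists (M * r + cn c) => z zr; rewrite hornerD hornerMX hornerC.
apply: (le_trans (cnD _ _)); rewrite lerD2r cnM ler_pM ?cn_ge0 ?HM //.
Qed.

(** The even part of [p] is [q (z^2)], where [q] has smaller degree than [p] and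
    the same value at [0]. If [w] is good for [q], one of its two square roots is
    good for [p], since [q w] is the mean of the values of [p] there. *)
Lemma max_principle p (r : R) : 0 <= r -> exists2 z, cn z = r & cn p.[0] <= cn p.[z].
Proof.
have [n] := ubnP (size p); elim: n p r => // n IH p r pn r0.
have [sp|sp] := leqP (size p) 1.
  exists r%:C; first by rewrite cn_real ger0_norm.
  by rewrite (size1_polyC sp) !hornerC.
have [||w wr Hw] := IH (even_poly p) (r ^+ 2).
- rewrite (leq_ltn_trans (size_even_poly p)) //.
  by move: pn sp; rewrite uphalf_half; move: (size p) => s; lia.
- exact: exprn_ge0.
pose z := sqrtc w.
have zw : z ^+ 2 = w by exact: sqr_sqrtc.
have cz : cn z = r.
  by apply/eqP; rewrite -(eqrXn2 (_ : 0 < 2)%N) ?cn_ge0 // -cnX zw wr.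
have E0 : p.[0] = (even_poly p).[0].
  by rewrite -{1}(poly_even_odd p) hornerD hornerMX mulr0 addr0 horner_comp hornerXn expr0n.
have Ez : p.[z] + p.[- z] = 2%:R * (even_poly p).[w].
  rewrite -{1 2}(poly_even_odd p) !hornerD !hornerMX !horner_comp !hornerXn sqrrN zw; ring.
have : 2 * cn (even_poly p).[w] <= cn p.[z] + cn p.[- z].
  apply: le_trans (cnD _ _); rewrite Ez cnM.
  have -> : cn (2%:R : C) = 2 by rewrite -(rmorph_nat (real_complex R)) cn_real normr_nat.
  by [].
rewrite E0 => H2; have [H|H] := leP (cn (even_poly p).[0]) (cn p.[z]); first by exists z.
exists (- z); first by rewrite cnN.
lra.
Qed.

Lemma entireB F G : entire F -> entire G -> entire (fun l => F l - G l).
Proof.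
move=> eF eG r e e0; have e2 : 0 < e / 2 by rewrite divr_gt0.
have [p Hp] := eF r _ e2; have [q Hq] := eG r _ e2.
exists (p - q) => l lr; rewrite hornerD hornerN.
have -> : p.[l] - q.[l] - (F l - G l) = (p.[l] - F l) - (q.[l] - G l) by ring.
apply: (le_trans (cnB _ _)); have := Hp l lr; have := Hq l lr; lra.
Qed.

Lemma entire_bounded F r : entire F -> exists M, forall l, cn l <= r -> cn (F l) <= M.
Proof.
move=> eF; have [p Hp] := eF r 1 ltr01; have [M HM] := cn_horner_bounded p r.
exists (M + 1) => l lr; rewrite (_ : F l = p.[l] - (p.[l] - F l)); last by ring.
by apply: (le_trans (cnB _ _)); rewrite lerD ?HM ?Hp.
Qed.

Lemma entireM F G : entire F -> entire G -> entire (fun l => F l * G l).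
Proof.
move=> eF eG r e e0.
have [A HA] := entire_bounded r eF; have [B HB] := entire_bounded r eG.
have nA : 0 < `|A| + 1 by rewrite ltr_pwDr.
have nB : 0 < `|B| + 1 by rewrite ltr_pwDr.
pose e1 := e / 2 / (`|B| + 1); have e10 : 0 < e1 by rewrite !divr_gt0.
have [p Hp] := eF r _ e10.
have [M HM] := cn_horner_bounded p r.
have nM : 0 < `|M| + 1 by rewrite ltr_pwDr.
pose e2 := e / 2 / (`|M| + 1); have e20 : 0 < e2 by rewrite !divr_gt0.
have [q Hq] := eG r _ e20.
exists (p * q) => l lr; rewrite hornerM.
have -> : p.[l] * q.[l] - F l * G l = p.[l] * (q.[l] - G l) + (p.[l] - F l) * G l by ring.
apply: (le_trans (cnD _ _)); rewrite !cnM.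
have t1 : cn p.[l] * cn (q.[l] - G l) <= (`|M| + 1) * e2.
  rewrite ler_pM ?cn_ge0 ?Hq // (le_trans (HM l lr)) // (le_trans (ler_norm M)) //.
  by rewrite lerDl.
have t2 : cn (p.[l] - F l) * cn (G l) <= e1 * (`|B| + 1).
  rewrite ler_pM ?cn_ge0 ?Hp // (le_trans (HB l lr)) // (le_trans (ler_norm B)) //.
  by rewrite lerDl.
have E1 : e1 * (`|B| + 1) = e / 2 by rewrite /e1 divfK // gt_eqF.
have E2 : (`|M| + 1) * e2 = e / 2 by rewrite /e2 mulrC divfK // gt_eqF.
lra.
Qed.

(** The maximum principle passes to locally uniform limits of polynomials. *)
Theorem liouville_zero F : entire F ->
  (forall e, 0 < e -> exists r0, forall l, r0 <= cn l -> cn (F l) <= e) -> F 0 = 0.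
Proof.
move=> eF dF; apply/eqP; rewrite -cn_eq0 eq_le cn_ge0 andbT.
apply/ler_addgt0Pr => e e0; rewrite add0r.
have e3 : 0 < e / 3 by rewrite divr_gt0.
have [r0 Hr] := dF _ e3; have [p Hp] := eF `|r0| _ e3.
have [z zr Hz] := max_principle p (normr_ge0 r0).
have := Hp z; rewrite zr lexx => /(_ isT) P1.
have := Hp 0; rewrite cn0 normr_ge0 => /(_ isT) P0.
have := Hr z; rewrite zr ler_norm => /(_ isT) P2.
have : cn (F 0) <= cn p.[0] + cn (p.[0] - F 0).
  by rewrite {1}(_ : F 0 = p.[0] - (p.[0] - F 0)); [exact: cnB|ring].
have : cn p.[z] <= cn (p.[z] - F z) + cn (F z).
  by rewrite -{1}(subrK (F z) p.[z]) cnD.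
lra.
Qed.

Lemma horner_bounds p : p != 0 -> exists c D r : R,
  [/\ 0 < c, 0 < D, 1 <= r & forall z, r <= cn z ->
    c * cn z ^+ (size p).-1 <= cn p.[z] <= D * cn z ^+ (size p).-1].
Proof.
elim/poly_ind: p => [|p a IH]; first by rewrite eqxx.
have [->|pn0] := eqVneq p 0.
  rewrite mul0r add0r polyC_eq0 => a0; exists (cn a), (cn a), 1; rewrite cn_gt0 a0;
    split => // z _.
  by rewrite size_polyC a0 hornerC expr0 mulr1 lexx.
move=> _; have [c [D [r [c0 D0 r1 H]]]] := IH pn0.
have sz : (size (p * 'X + a%:P)).-1 = (size p).-1.+1.
  by rewrite size_MXaddC (negbTE pn0) /= prednK // size_poly_gt0.
exists (c / 2), (D + 1), (Num.max r (Num.max (cn a) (2 * cn a / c))); split.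
- by rewrite divr_gt0.
- by rewrite addr_gt0.
- by rewrite le_max r1.
move=> z; rewrite !ge_max => /andP[rz /andP[az az2]].
have /andP[lo hi] := H z rz; rewrite sz hornerD hornerMX hornerC exprS.
have z1 : 1 <= cn z by exact: le_trans rz.
set w := cn z ^+ _ in lo hi *.
have w1 : 1 <= w by rewrite exprn_ege1.
have zw : cn z <= cn z * w by rewrite ler_peMr ?cn_ge0.
have a2 : 2 * cn a <= c * (cn z * w).
  move: az2; rewrite ler_pdivrMr // => a2; apply: (le_trans a2); rewrite mulrC ler_pM2l //.
have l1 : c * w * cn z <= cn p.[z] * cn z by rewrite ler_wpM2r ?cn_ge0.
have l2 : cn p.[z] * cn z <= D * w * cn z by rewrite ler_wpM2r ?cn_ge0.
apply/andP; split.
  have : cn (p.[z] * z) <= cn (p.[z] * z + a) + cn a.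
    by rewrite -{1}(addrK a (p.[z] * z)) cnB.
  rewrite cnM; lra.
apply: (le_trans (cnD _ _)); rewrite cnM; lra.
Qed.

(** As functions of [m], [m p(- m^2)] has odd degree and [q(- m^2)] even degree, so
    they never have the same order of magnitude. *)
Theorem dominance p q : (p != 0) || (q != 0) -> exists r : R, forall (m : C), r <= cn m ->
  0 < cn m * cn p.[- m ^+ 2] + cn q.[- m ^+ 2] /\
  (4 * cn q.[- m ^+ 2] <= cn m * cn p.[- m ^+ 2] \/
   4 * (cn m * cn p.[- m ^+ 2]) <= cn q.[- m ^+ 2]).
Proof.
have cl (m : C) : cn (- m ^+ 2) = cn m ^+ 2 by rewrite cnN cnX.
have big (m : C) (r : R) : 1 <= r -> r <= cn m -> r <= cn (- m ^+ 2).
  move=> r1 rm; rewrite cl expr2; apply: (le_trans rm); rewrite ler_peMl ?cn_ge0 //.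
  exact: le_trans rm.
have [->|p0] := eqVneq p 0; have [->|q0] := eqVneq q 0 => //= _.
- have [c [D [r [c0 D0 r1 H]]]] := horner_bounds q0.
  exists r => m rm; rewrite horner0 cn0 mulr0 add0r mulr0; split; last by right;
    exact: cn_ge0.
  have /andP[lo _] := H _ (big m r r1 rm); apply: lt_le_trans lo.
  rewrite mulr_gt0 // exprn_gt0 // (lt_le_trans _ (big m r r1 rm)) //; lra.
- have [c [D [r [c0 D0 r1 H]]]] := horner_bounds p0.
  exists r => m rm; rewrite horner0 cn0 mulr0 addr0; split; last by left;
    rewrite mulr_ge0 ?cn_ge0.
  have /andP[lo _] := H _ (big m r r1 rm); rewrite mulr_gt0 //; first by lra.
  apply: lt_le_trans lo.
  rewrite mulr_gt0 // exprn_gt0 // (lt_le_trans _ (big m r r1 rm)) //; lra.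
have [c [D [r [c0 D0 r1 H]]]] := horner_bounds p0.
have [c' [D' [r' [c'0 D'0 r'1 H']]]] := horner_bounds q0.
exists (Num.max (Num.max r r') (Num.max (4 * D' / c) (4 * D / c'))) => m.
rewrite !ge_max => /andP[/andP[rm r'm] /andP[]].
rewrite !ler_pdivrMr // => b1 b2.
have m1 : 1 <= cn m by exact: le_trans rm.
have /andP[lo hi] := H _ (big m r r1 rm).
have /andP[lo' hi'] := H' _ (big m r' r'1 r'm).
have l1 : 1 <= cn (- m ^+ 2) by exact: big.
move: lo hi lo' hi'; set P := cn p.[_]; set Q := cn q.[_]; rewrite cl in l1 *.
set s := cn m ^+ 2 in l1 *; move=> lo hi lo' hi'.
have P0 : 0 < P by apply: lt_le_trans lo; rewrite mulr_gt0 // exprn_gt0 //; lra.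
have Q0 : 0 <= Q by exact: cn_ge0.
split; first by rewrite ltr_wpDr // mulr_gt0 //; lra.
have [qp|pq] := leqP (size q) (size p).
  left; have e1 : s ^+ (size q).-1 <= s ^+ (size p).-1.
    by rewrite ler_weXn2l // -!subn1 leq_sub2r.
  have e0 : 0 <= s ^+ (size p).-1 by rewrite exprn_ge0 //; lra.
  have f1 : D' * s ^+ (size q).-1 <= D' * s ^+ (size p).-1 by rewrite ler_wpM2l // ltW.
  have f2 : 4 * D' * s ^+ (size p).-1 <= cn m * c * s ^+ (size p).-1 by rewrite ler_wpM2r.
  have f3 : cn m * (c * s ^+ (size p).-1) <= cn m * P by rewrite ler_wpM2l ?cn_ge0.
  lra.
right; have e1 : s ^+ (size p).-1.+1 <= s ^+ (size q).-1.
  by rewrite ler_weXn2l // prednK ?size_poly_gt0 // -ltnS prednK // size_poly_gt0.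
rewrite exprS in e1.
have e0 : 0 <= s ^+ (size p).-1 by rewrite exprn_ge0 //; lra.
have f1 : c' * (s * s ^+ (size p).-1) <= c' * s ^+ (size q).-1 by rewrite ler_wpM2l // ltW.
have f2 : cn m * (4 * D) * s ^+ (size p).-1 <= cn m * (cn m * c') * s ^+ (size p).-1.
  by rewrite ler_wpM2r // ler_wpM2l ?cn_ge0.
have f3 : cn m * P <= cn m * (D * s ^+ (size p).-1) by rewrite ler_wpM2l ?cn_ge0.
have f4 : cn m * (cn m * c') * s ^+ (size p).-1 = c' * (s * s ^+ (size p).-1) by rewrite /s; ring.
lra.
Qed.

Lemma horner_eventually_neq0 p : p != 0 ->
  exists r : R, forall m : C, r <= cn m -> p.[- m ^+ 2] != 0.
Proof.
move=> p0; have [|r Hr] := @dominance p 0; first by rewrite p0.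
exists r => m rm; have [+ _] := Hr m rm.
by rewrite horner0 cn0 addr0; apply: contraTneq => ->; rewrite cn0 mulr0 ltxx.
Qed.

End Liouville.

(** * From the Weyl function to the potential *)

Section Assembly.
Variable R : realType.
Notation C := R[i].

(** The terms with [sigma] and [l] cancel in the derivative of the Wronskian. *)
Lemma wronskian_const (sigma : R -> C) (l : C) (y v y' v' : R -> C) :
  solves sigma l y v -> solves sigma l y' v' ->
  forall x, 0 <= x <= pi -> y x * v' x - v x * y' x = y 0 * v' 0 - v 0 * y' 0.
Proof.
move=> [py pv] [py' pv'] x xpi.
apply: (ac_cprim_const (ac_cprimB (ac_cprimM py pv') (ac_cprimM pv py')) _ xpi).
by apply: ae_0pi_all => t _; ring.
Qed.

(** Read off from the three Wronskians of [y], [c] and [s], the last one being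
    [1]. *)
Lemma solves_decomposition (sigma : R -> C) (l : C) (c cq s sq y v : R -> C) :
  solves sigma l c cq -> c 0 = 1 -> cq 0 = 0 ->
  solves sigma l s sq -> s 0 = 0 -> sq 0 = 1 -> solves sigma l y v ->
  forall x, 0 <= x <= pi -> y x = y 0 * c x + v 0 * s x.
Proof.
move=> Sc c0 cq0 Ss s0 sq0 Sy x xpi.
have := wronskian_const Sc Ss xpi; have := wronskian_const Sy Ss xpi.
have := wronskian_const Sy Sc xpi; rewrite c0 cq0 s0 sq0 => w1 w2 w3.
have -> : y x = y x * (c x * sq x - cq x * s x) by rewrite w3; ring.
have -> : y x * (c x * sq x - cq x * s x) =
   c x * (y x * sq x - v x * s x) - s x * (y x * cq x - v x * c x) by ring.
by rewrite w1 w2; ring.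
Qed.

(** Let [D = s ct - c st] vanish, and let [Q], [P], [V] be the other entries of the
    comparison matrix up to sign. The derivative of [D] is [Q - P] up to a multiple
    of [D], so [Q = P]. The derivative of [Q + P] is [(sigmat - sigma) (Q - P)] up to
    a multiple of [D], so [Q + P = 2] and [Q = P = 1]. The derivative of [Q - P] then
    gives [V = sigma - sigmat] a.e.; with this the derivative of [V] vanishes, so
    that [V] keeps its value [0] at the left endpoint. *)
Lemma potential_unique (sigma sigmat : R -> C) (l : C) (c cq s sq ct ctq st stq : R -> C) :
  solves sigma l c cq -> c 0 = 1 -> cq 0 = 0 ->
  solves sigma l s sq -> s 0 = 0 -> sq 0 = 1 ->
  solves sigmat l ct ctq -> ct 0 = 1 -> ctq 0 = 0 ->
  solves sigmat l st stq -> st 0 = 0 -> stq 0 = 1 ->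
  (forall x, 0 <= x <= pi -> s x * ct x - c x * st x = 0) ->
  ae_0pi (fun x => sigma x = sigmat x).
Proof.
move=> [pc pcq] c0 cq0 [ps psq] s0 sq0 [pct pctq] ct0 ctq0 [pst pstq] st0 stq0 D0.
pose Q x := sq x * ct x - cq x * st x.
pose P x := c x * stq x - s x * ctq x.
pose V x := sq x * ctq x - cq x * stq x.
have pQ := ac_cprimB (ac_cprimM psq pct) (ac_cprimM pcq pst).
have pP := ac_cprimB (ac_cprimM pc pstq) (ac_cprimM ps pctq).
have pV := ac_cprimB (ac_cprimM psq pctq) (ac_cprimM pcq pstq).
have dD := ac_cprim_zero (ac_cprimB (ac_cprimM ps pct) (ac_cprimM pc pst)) D0.
have QP : ae_0pi (fun x => Q x - P x = 0).
  apply: ae_0pi_mp dD => x /andP[/ltW x0 /ltW xp] dx.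
  have D0x : s x * ct x - c x * st x = 0 by apply: D0; rewrite x0.
  rewrite -dx /Q /P.
  rewrite -[LHS]addr0 -(mulr0 (sigma x + sigmat x)) -D0x; ring.
have QP0 x : 0 <= x <= pi -> Q x - P x = 0.
  apply: (ac_cprim_ae0 (ac_cprimB pQ pP) QP).
  by rewrite c0 cq0 s0 sq0 ct0 ctq0 st0 stq0; ring.
have QPsum x : 0 <= x <= pi -> Q x + P x = 1 + 1.
  move=> xpi; rewrite /Q /P (ac_cprim_const (ac_cprimD pQ pP) _ xpi).
    by rewrite c0 cq0 s0 sq0 ct0 ctq0 st0 stq0; ring.
  apply: ae_0pi_all => t /andP[/ltW t0 /ltW tp].
  have tpi : 0 <= t <= pi by rewrite t0.
  have h1 := QP0 t tpi; have h2 := D0 t tpi.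
  transitivity ((sigmat t - sigma t) * (Q t - P t)
    + (sigmat t ^+ 2 - sigma t ^+ 2) * (s t * ct t - c t * st t)).
    by rewrite /Q /P; ring.
  by rewrite h1 h2; ring.
have [Q1 P1] : (forall x, 0 <= x <= pi -> Q x = 1) /\ (forall x, 0 <= x <= pi -> P x = 1).
  have two : (2%:R : C) != 0 by rewrite pnatr_eq0.
  split=> x xpi; apply: (mulfI two); have h1 := QP0 x xpi; have h2 := QPsum x xpi.
    transitivity ((Q x + P x) + (Q x - P x)); first by ring.
    by rewrite h1 h2; ring.
  transitivity ((Q x + P x) - (Q x - P x)); first by ring.
  by rewrite h1 h2; ring.
have VE : ae_0pi (fun x => V x = sigma x - sigmat x).
  apply: ae_0pi_mp (ac_cprim_zero (ac_cprimB pQ pP) QP0) => t /andP[/ltW t0 /ltW tp] E.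
  have tpi : 0 <= t <= pi by rewrite t0.
  have two : (2%:R : C) != 0 by rewrite pnatr_eq0.
  apply: (mulfI two); have h2 := D0 t tpi.
  have q1 := Q1 t tpi; have p1 := P1 t tpi.
  have : (sigmat t - sigma t) * (Q t + P t) + 2%:R * V t
      - (sigma t ^+ 2 + sigmat t ^+ 2 + l + l) * (s t * ct t - c t * st t) = 0.
    by rewrite -[RHS]E /Q /P /V; ring.
  rewrite q1 p1 h2 => E'.
  transitivity (2%:R * (sigma t - sigmat t) + ((sigmat t - sigma t) * (1 + 1) + 2%:R * V t
     - (sigma t ^+ 2 + sigmat t ^+ 2 + l + l) * 0)); first by ring.
  by rewrite E' addr0.
have V0 x : 0 <= x <= pi -> V x = 0.
  move=> xpi; rewrite /V (ac_cprim_const pV _ xpi).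
    by rewrite cq0 sq0 ctq0 stq0; ring.
  apply: ae_0pi_mp VE => t /andP[/ltW t0 /ltW tp] E.
  have tpi : 0 <= t <= pi by rewrite t0.
  have h2 := D0 t tpi; have q1 := Q1 t tpi; have p1 := P1 t tpi.
  transitivity (- (sigma t + sigmat t) * V t + (sigma t ^+ 2 + l) * P t - (sigmat t ^+ 2 + l) * Q t).
    by rewrite /V /P /Q; ring.
  by rewrite E q1 p1; ring.
apply: ae_0pi_mp VE => x /andP[/ltW x0 /ltW xp].
by rewrite V0 ?x0 // => /esym/eqP; rewrite subr_eq0 => /eqP.
Qed.

(** What is needed of a problem for [l = - m^2] with large [Re m]. In the [l]-plane
    this excludes a parabolic neighbourhood of the positive half-line, where the
    eigenvalues accumulate. *)
Definition regular_half_plane (L : problem R) (psi psiq : R -> C -> C) (K : R) :=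
  forall m : C,
  K <= complex.Re m -> let l := - m ^+ 2 in
  [/\ psi 0 l != 0,
      forall x, 0 <= x <= pi -> cn (psi x l) <=
        K * cn (psi 0 l) * expR (- (complex.Re m * x)),
      weyl_denominator L psi psiq l != 0 & (p1 L).[l] != 0].

Lemma Re_le_modulus (m : C) : complex.Re m <= cn m.
Proof. by apply: le_trans (Re_le_cn m); exact: ler_norm. Qed.

Lemma dominated_sum (u w : C) : 4 * cn w <= cn u \/ 4 * cn u <= cn w ->
  0 < cn u + cn w -> exists2 M : R, 0 < M &
  3 / 4 * M <= cn (u + w) /\ cn (u - w) <= 5 / 4 * M.
Proof.
have t1 : cn u <= cn (u + w) + cn w by rewrite -{1}(addrK w u) cnB.
have t2 : cn w <= cn (u + w) + cn u by rewrite -{1}(addrK u w) addrC [w + u]addrC addrC cnB.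
have t3 := cnB u w; have u0 := cn_ge0 u; have w0 := cn_ge0 w.
by move=> [H|H] pos; [exists (cn u)|exists (cn w)]; try lra; split; lra.
Qed.

(** By [dominance] for [r1, r2], the decaying component of [psi] at [pi] is not
    small, so that [decay] applies. By [dominance] for [p1, p2] and since the growing
    component at [0] is at most a quarter of the decaying one, the denominator of the
    Weyl function cannot vanish. *)
Lemma exists_regular_half_plane (L : problem R) psi psiq :
  L2_0pi (sigma L) -> (r1 L != 0) || (r2 L != 0) -> p1 L != 0 -> is_psi L psi psiq ->
  exists2 K, 1 <= K & regular_half_plane L psi psiq K.
Proof.
move=> sL2 r0 p0 hpsi.
have [K K1 HK] := decay sL2.
have [ra Ha] := dominance r0.
have [rb Hb] : exists r : R, forall m : C, r <= cn m ->
  0 < cn m * cn (p1 L).[- m ^+ 2] + cn (p2 L).[- m ^+ 2] /\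
  (4 * cn (p2 L).[- m ^+ 2] <= cn m * cn (p1 L).[- m ^+ 2] \/
   4 * (cn m * cn (p1 L).[- m ^+ 2]) <= cn (p2 L).[- m ^+ 2]).
  by apply: dominance; rewrite p0.
have [rc Hc] := horner_eventually_neq0 p0.
pose K' := Num.max (Num.max K ra) (Num.max rb rc).
have KK' : K <= K' by rewrite !le_max lexx.
exists K'; first exact: le_trans KK'.
move=> m mK l.
have := le_trans mK (Re_le_modulus m);
  rewrite !ge_max => /andP[/andP[Km ram] /andP[rbm rcm]].
have m1 : 1 <= cn m by exact: le_trans Km.
have mn0 : m != 0 by rewrite -cn_gt0; lra.
have [/is_solution_solves yv ypi vpi] := hpsi l.
set y := psi ^~ l in yv; set v := psiq ^~ l in yv.
have [pos1 dom1] := Ha m ram; rewrite -/l in pos1 dom1.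
have [||M M0 [lo hi]] := @dominated_sum (m * (r1 L).[l]) (r2 L).[l].
- by rewrite cnM; exact: dom1.
- by rewrite cnM.
have dwE : down_wave m y v pi = m * (r1 L).[l] + (r2 L).[l].
  by rewrite /down_wave /y /v ypi vpi opprK.
have uwE : up_wave m y v pi = m * (r1 L).[l] - (r2 L).[l].
  by rewrite /up_wave /y /v ypi vpi.
have S1 : wave_size m y v pi <=
  4 * cn (down_wave m y v pi) by rewrite /wave_size dwE uwE; lra.
have S2 : 0 < wave_size m y v pi by rewrite /wave_size dwE uwE; have :=
  cn_ge0 (m * (r1 L).[l] - (r2 L).[l]); lra.
have [d1 d2 d3] := HK m y v yv (le_trans KK' mK) S1 S2.
have y00 : psi 0 l != 0.
  rewrite -cn_gt0.
  have H2 := wave_sum m y v 0.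
  have := cnB (down_wave m y v 0 + up_wave m y v 0) (up_wave m y v 0);
    rewrite addrK H2 => H3.
  have : 0 < 2 * cn m * cn (psi 0 l) by lra.
  by rewrite pmulr_rgt0 // mulr_gt0 //; lra.
have [pos2 dom2] := Hb m rbm; rewrite -/l in pos2 dom2.
have p1n := Hc m rcm.
split => //.
  move=> x xpi; apply: (le_trans (d3 x xpi)).
  by rewrite ler_wpM2r ?expR_ge0 // ler_wpM2r ?cn_ge0.
have [||N N0 [lo2 hi2]] := @dominated_sum (m * (p1 L).[l]) (p2 L).[l].
- by rewrite cnM; exact: dom2.
- by rewrite cnM.
have E : 2%:R * m * weyl_denominator L psi psiq l =
   up_wave m y v 0 * (m * (p1 L).[l] - (p2 L).[l]) - down_wave m y v 0 * (m * (p1 L).[l] + (p2 L).[l]).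
  by rewrite /weyl_denominator /up_wave /down_wave /y /v; ring.
apply/eqP => W0; move: E; rewrite W0 mulr0 => /esym/eqP; rewrite subr_eq0 => /eqP E.
have := congr1 cn E; rewrite !cnM => E2.
have i1 : cn (up_wave m y v 0) * cn (m * (p1 L).[l] - (p2 L).[l]) <=
  cn (down_wave m y v 0) / 4 * (5 / 4 * N).
  by rewrite ler_pM ?cn_ge0 //; lra.
have i2 : cn (down_wave m y v 0) * (3 / 4 * N) <=
  cn (down_wave m y v 0) * cn (m * (p1 L).[l] + (p2 L).[l]).
  by rewrite ler_wpM2l ?cn_ge0.
have i3 : 0 < cn (down_wave m y v 0) * N by rewrite mulr_gt0.
lra.
Qed.

(** Cross-multiplied, the terms with [p2] cancel and [p1] factors out. *)
Lemma weyl_cross (L Lt : problem R) psi psiq psit psitq K Kt (m : C) :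
  regular_half_plane L psi psiq K -> regular_half_plane Lt psit psitq Kt ->
  weyl_eq L psi psiq Lt psit psitq -> p1 L = p1 Lt -> p2 L = p2 Lt ->
  K <= complex.Re m -> Kt <= complex.Re m ->
  psi 0 (- m ^+ 2) * psitq 0 (- m ^+ 2) = psit 0 (- m ^+ 2) * psiq 0 (- m ^+ 2).
Proof.
move=> HL HLt hM e1 e2 Km Ktm; set l := - m ^+ 2.
have [_ _ W P] := HL m Km; have [_ _ Wt _] := HLt m Ktm.
have := hM l W Wt; rewrite /weyl => /oppr_inj E.
have {}E : psi 0 l * weyl_denominator Lt psit psitq l = psit 0 l * weyl_denominator L psi psiq l.
  by apply/eqP; rewrite -eqr_div //; apply/eqP.
apply: (mulfI P); move: E; rewrite /weyl_denominator -e1 -e2 => E.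
transitivity (psi 0 l * ((p1 L).[l] * psitq 0 l - (p2 L).[l] * psit 0 l) + (p2 L).[l] * psit 0 l * psi 0 l); first by ring.
by rewrite E; ring.
Qed.

End Assembly.

(** * Normalized boundary polynomials *)

Section NormalizedPolys.
Variable R : realType.
Notation C := R[i].
Implicit Types r s : {poly C}.

Lemma normalized_neq0 r1 r2 : normalized r1 r2 -> (r1 != 0) || (r2 != 0).
Proof.
move=> [M1 [M2 [_ _]]]; case: ifP => _ [_ E]; apply/orP; [left|right];
  by apply: contra_eq_neq E => ->; rewrite coef0 eq_sym oner_eq0.
Qed.

(** The coefficient required to be [1] is the leading one of [r1] or of [r2],
    depending only on the sizes, which scaling preserves. *)
Lemma normalized_scale r1 r2 (k : C) : k != 0 ->
  normalized r1 r2 -> normalized (k *: r1) (k *: r2) -> k = 1.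
Proof.
move=> k0 [M1 [M2 [s1 s2 H]]] [N1 [N2 [t1 t2 T]]].
rewrite !size_scale // in t1 t2 T.
have lead (p : {poly C}) (M N : nat) : (size p <= M.+1)%N -> (size p <= N.+1)%N ->
    p`_M = 1 -> (k *: p)`_N = 1 -> k = 1.
  move=> sM sN E; rewrite coefZ => E'.
  have pM : size p = M.+1.
    apply/eqP; rewrite eqn_leq sM ltnNge; apply/negP => /leq_sizeP/(_ M (leqnn _)) E0.
    by move: E; rewrite E0 => /eqP; rewrite eq_sym oner_eq0.
  have pN : size p = N.+1.
    apply/eqP; rewrite eqn_leq sN ltnNge; apply/negP => /leq_sizeP/(_ N (leqnn _)) E0.
    by move: E'; rewrite E0 mulr0 => /eqP; rewrite eq_sym oner_eq0.
  have NM : N = M by move: pN; rewrite pM => -[].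
  by move: E'; rewrite NM E mulr1.
move: H T; case: ifP => _ [e1 E] [e2 E'].
  exact: lead s1 t1 E E'.
exact: lead s2 t2 E E'.
Qed.

(** By Gauss' lemma corresponding polynomials divide each other, so the two pairs
    are proportional. *)
Lemma normalized_coprime_unique r1 r2 s1 s2 :
  coprimep r1 r2 -> coprimep s1 s2 -> normalized r1 r2 -> normalized s1 s2 ->
  r1 * s2 = r2 * s1 -> r1 = s1 /\ r2 = s2.
Proof.
move=> cr cs nr ns E.
have d1 : r1 %| s1 by rewrite -(Gauss_dvdpr _ cr) -E dvdp_mulr.
have d1' : s1 %| r1 by rewrite -(Gauss_dvdpl _ cs) E dvdp_mull.
have cr' : coprimep r2 r1 by rewrite coprimep_sym.
have cs' : coprimep s2 s1 by rewrite coprimep_sym.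
have d2 : r2 %| s2 by rewrite -(Gauss_dvdpr _ cr') E dvdp_mulr.
have d2' : s2 %| r2 by rewrite -(Gauss_dvdpl _ cs') -E dvdp_mull.
suff [k k0 [e1 e2]] : exists2 k : C, k != 0 & s1 = k *: r1 /\ s2 = k *: r2.
  move: ns; rewrite e1 e2 => /(normalized_scale k0 nr) ->.
  by rewrite !scale1r.
have scaled (p q : {poly C}) : p %| q -> q %| p -> exists2 k : C, k != 0 & q = k *: p.
  move=> pq qp; have /eqpP[[c1 c2] /= /andP[c10 c20] e] : p %= q by rewrite /eqp pq qp.
  exists (c2^-1 * c1); first by rewrite mulf_neq0 ?invr_eq0.
  by rewrite -scalerA e scalerA mulVf // scale1r.
have [r10|r10] := eqVneq r1 0.
  have [k k0 e2] := scaled _ _ d2 d2'; exists k => //; split => //.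
  by move: d1; rewrite r10 scaler0 dvd0p => /eqP.
have [k k0 e1] := scaled _ _ d1 d1'; exists k => //; split => //.
apply: (mulfI r10); rewrite E e1; rewrite -!mul_polyC; ring.
Qed.

Lemma poly_eq0_large (p : {poly C}) (K : R) :
  (forall m : C, K <= complex.Re m -> p.[- m ^+ 2] = 0) -> p = 0.
Proof.
move=> H; apply/eqP; apply/negP => /negP /horner_eventually_neq0[r Hr].
pose t := Num.max r K.
have rt : r <= cn t%:C.
  by rewrite cn_real; apply: le_trans (ler_norm t); rewrite le_max lexx.
by have := Hr _ rt; rewrite H ?eqxx //= le_max lexx orbT.
Qed.

End NormalizedPolys.

(** * The uniqueness theorem *)

Section Main.
Variable R : realType.
Notation C := R[i].

Lemma half_plane_sqrt (l : C) : exists2 m : C, l = - m ^+ 2 & 0 <= complex.Re m.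
Proof.
pose m := sqrtc (- l); have mE : l = - m ^+ 2 by rewrite sqr_sqrtc opprK.
have [H|/ltW H] := leP 0 (complex.Re m); first by exists m.
by exists (- m); [rewrite sqrrN|rewrite ReN oppr_ge0].
Qed.

(** For [Re m <= K] the growth of the four fundamental solutions suffices. For
    [Re m >= K], eliminate [c] and [ct] with [psi = psi(0) c + psi^[1](0) s] and its
    analogue: by [weyl_cross] the terms with [s st] cancel, and [psi], [psit] decay at
    the rate at which [s], [st] grow. *)
Lemma cross_product_decay (L Lt : problem R) psi psiq psit psitq K0 Kt0
    (c cq s sq ct ctq st stq : R -> C -> C) (x : R) :
  0 <= x <= pi ->
  is_psi L psi psiq -> is_psi Lt psit psitq ->
  L2_0pi (sigma L) -> L2_0pi (sigma Lt) ->
  regular_half_plane L psi psiq K0 -> regular_half_plane Lt psit psitq Kt0 ->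
  weyl_eq L psi psiq Lt psit psitq -> p1 L = p1 Lt -> p2 L = p2 Lt ->
  (forall l, [/\ solves (sigma L) l (c ^~ l) (cq ^~ l), c 0 l = 1 & cq 0 l = 0]) ->
  (forall l, [/\ solves (sigma L) l (s ^~ l) (sq ^~ l), s 0 l = 0 & sq 0 l = 1]) ->
  (forall l, [/\ solves (sigma Lt) l (ct ^~ l) (ctq ^~ l), ct 0 l = 1 & ctq 0 l = 0]) ->
  (forall l, [/\ solves (sigma Lt) l (st ^~ l) (stq ^~ l), st 0 l = 0 & stq 0 l = 1]) ->
  exists B : R, forall m : C, 1 <= cn m -> 0 <= complex.Re m ->
    let l := - m ^+ 2 in cn m * cn (s x l * ct x l - c x l * st x l) <= B.
Proof.
move=> xpi hpsi hpsit sL2 stL2 HL HLt hM e1 e2 Hc Hs Hct Hst.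
have [K1 K11 G1] := growth sL2; have [K2 K21 G2] := growth stL2.
pose K := Num.max (Num.max K1 K2) (Num.max K0 Kt0).
have [K1K K2K K0K KtK] : [/\ K1 <= K, K2 <= K, K0 <= K & Kt0 <= K].
  by rewrite /K !le_max !lexx !orbT.
have Kge1 : 1 <= K by exact: le_trans K1K.
exists (2 * K ^+ 2 * expR (K * pi) ^+ 2).
move=> m m1 k0; set l := - m ^+ 2; rewrite /=.
have [Sc c0 cq0] := Hc l; have [Ss s0 sq0] := Hs l.
have [Sct ct0 ctq0] := Hct l; have [Sst st0 stq0] := Hst l.
have m0 : 0 < cn m by lra.
set k := complex.Re m in k0 *.
set E := expR (k * x).
have E0 : 0 < E by exact: expR_gt0.
have bs : cn m * cn (s x l) <= K * E.
  have := G1 m _ _ Ss m1 k0 x xpi; rewrite s0 sq0 cn0 cn1 mulr0 add0r mulr1 => /le_trans;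
    apply.
  by rewrite ler_wpM2r ?expR_ge0.
have bst : cn m * cn (st x l) <= K * E.
  have := G2 m _ _ Sst m1 k0 x xpi;
    rewrite st0 stq0 cn0 cn1 mulr0 add0r mulr1 => /le_trans; apply.
  by rewrite ler_wpM2r ?expR_ge0.
have bc : cn (c x l) <= K * E.
  have := G1 m _ _ Sc m1 k0 x xpi; rewrite c0 cq0 cn0 cn1 mulr1 addr0.
  rewrite mulrAC mulrC ler_pM2r // => /le_trans; apply.
  by rewrite ler_wpM2r ?expR_ge0.
have bct : cn (ct x l) <= K * E.
  have := G2 m _ _ Sct m1 k0 x xpi; rewrite ct0 ctq0 cn0 cn1 mulr1 addr0.
  rewrite mulrAC mulrC ler_pM2r // => /le_trans; apply.
  by rewrite ler_wpM2r ?expR_ge0.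
have [x0 xp] := andP xpi.
have [kK|/ltW Kk] := leP k K.
  have EK : E <= expR (K * pi) by rewrite ler_expR ler_pM.
  have E2 : (K * E) * (K * E) <= K ^+ 2 * expR (K * pi) ^+ 2.
    have -> : K ^+ 2 * expR (K * pi) ^+ 2 = (K * expR (K * pi)) * (K * expR (K * pi)) by ring.
    by rewrite ler_pM ?mulr_ge0 ?(ltW E0) ?ler_wpM2l //; lra.
  have f1 : cn m * cn (s x l) * cn (ct x l) <= (K * E) * (K * E).
    by rewrite ler_pM ?mulr_ge0 ?cn_ge0.
  have f2 : cn m * cn (st x l) * cn (c x l) <= (K * E) * (K * E).
    by rewrite ler_pM ?mulr_ge0 ?cn_ge0.
  have := ler_wpM2l (ltW m0) (cnB (s x l * ct x l) (c x l * st x l)).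
  rewrite [cn (s x l * _)]cnM [cn (c x l * _)]cnM.
  clear -f1 f2 E2; lra.
have [n0 dec _ _] := HL m (le_trans K0K Kk).
have [nt0 dect _ _] := HLt m (le_trans KtK Kk).
have X := weyl_cross HL HLt hM e1 e2 (le_trans K0K Kk) (le_trans KtK Kk).
rewrite -/l in n0 dec nt0 dect X.
have [/is_solution_solves Sp _ _] := hpsi l; have [/is_solution_solves Spt _ _] := hpsit l.
have D1 := solves_decomposition Sc c0 cq0 Ss s0 sq0 Sp xpi.
have D2 := solves_decomposition Sct ct0 ctq0 Sst st0 stq0 Spt xpi.
have ID : (s x l * ct x l - c x l * st x l) * (psi 0 l * psit 0 l) =
   s x l * psi 0 l * psit x l - st x l * psit 0 l * psi x l.
  rewrite D1 D2.
  transitivity ((s x l * ct x l - c x l * st x l) * (psi 0 l * psit 0 l) +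
     s x l * st x l * (psi 0 l * psitq 0 l - psit 0 l * psiq 0 l)); last by ring.
  by rewrite X subrr mulr0 addr0.
have EN : expR (- (k * x)) * E = 1 by rewrite /E -expRD addNr expR0.
have d1 : cn (psi x l) <= K * cn (psi 0 l) * expR (- (k * x)).
  by apply: (le_trans (dec x xpi)); rewrite ler_wpM2r ?expR_ge0 // ler_wpM2r ?cn_ge0.
have d2 : cn (psit x l) <= K * cn (psit 0 l) * expR (- (k * x)).
  by apply: (le_trans (dect x xpi)); rewrite ler_wpM2r ?expR_ge0 // ler_wpM2r ?cn_ge0.
have pp : 0 < cn (psi 0 l) * cn (psit 0 l) by rewrite mulr_gt0 ?cn_gt0.
rewrite -(ler_pM2r pp).
have KE0 : 0 <= K * E by rewrite mulr_ge0 ?(ltW E0) //; lra.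
have g1 : cn m * cn (s x l) * cn (psi 0 l) * cn (psit x l) <=
    K ^+ 2 * (cn (psi 0 l) * cn (psit 0 l)).
  have -> : K ^+ 2 * (cn (psi 0 l) * cn (psit 0 l)) =
     K * E * cn (psi 0 l) * (K * cn (psit 0 l) * expR (- (k * x))).
    transitivity (K ^+ 2 * (cn (psi 0 l) * cn (psit 0 l)) * (expR (- (k * x)) * E));
      last by ring.
    by rewrite EN mulr1.
  by rewrite ler_pM ?mulr_ge0 ?cn_ge0 // ler_wpM2r ?cn_ge0.
have g2 : cn m * cn (st x l) * cn (psit 0 l) * cn (psi x l) <=
    K ^+ 2 * (cn (psi 0 l) * cn (psit 0 l)).
  have -> : K ^+ 2 * (cn (psi 0 l) * cn (psit 0 l)) =
     K * E * cn (psit 0 l) * (K * cn (psi 0 l) * expR (- (k * x))).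
    transitivity (K ^+ 2 * (cn (psi 0 l) * cn (psit 0 l)) * (expR (- (k * x)) * E));
      last by ring.
    by rewrite EN mulr1.
  by rewrite ler_pM ?mulr_ge0 ?cn_ge0 // ler_wpM2r ?cn_ge0.
have := ler_wpM2l (ltW m0) (cnB (s x l * psi 0 l * psit x l) (st x l * psit 0 l * psi x l)).
rewrite -ID !cnM => g3.
have e1' : 1 <= expR (K * pi) ^+ 2.
  by rewrite exprn_ege1 // -expR0 ler_expR mulr_ge0 ?pi_ge0 //; lra.
have g4 : 2 * K ^+ 2 * (cn (psi 0 l) * cn (psit 0 l)) <=
   2 * K ^+ 2 * expR (K * pi) ^+ 2 * (cn (psi 0 l) * cn (psit 0 l)).
  by rewrite ler_wpM2r ?(ltW pp) // ler_peMr // mulr_ge0 ?sqr_ge0.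
clear -g1 g2 g3 g4; lra.
Qed.

End Main.

Theorem corollary2p4 (R : realType) (L Lt : problem R)
    (psi psiq psit psitq : R -> R[i] -> R[i])
    (hL : problem_ok L) (hLt : problem_ok Lt)
    (hr : normalized (r1 L) (r2 L)) (hrt : normalized (r1 Lt) (r2 Lt))
    (hpsi : is_psi L psi psiq) (hpsit : is_psi Lt psit psitq)
    (hp1_neq0 : p1 L != 0)
    (hM : weyl_eq L psi psiq Lt psit psitq)
    (hp1 : p1 L = p1 Lt) (hp2 : p2 L = p2 Lt) :
  ae_0pi (fun x => sigma L x = sigma Lt x) /\
  r1 L = r1 Lt /\ r2 L = r2 Lt.
Proof.
have [sL2 _ cr] := hL; have [stL2 _ crt] := hLt.
have pt0 : p1 Lt != 0 by rewrite -hp1.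
have [K K1 HL] := exists_regular_half_plane sL2 (normalized_neq0 hr) hp1_neq0 hpsi.
have [Kt Kt1 HLt] := exists_regular_half_plane stL2 (normalized_neq0 hrt) pt0 hpsit.
have [c [cq [Hc ec]]] := solution_family sL2 1 0.
have [s [sq [Hs es]]] := solution_family sL2 0 1.
have [ct [ctq [Hct ect]]] := solution_family stL2 1 0.
have [st [stq [Hst est]]] := solution_family stL2 0 1.
have D0 x : 0 <= x <= pi -> s x 0 * ct x 0 - c x 0 * st x 0 = 0.
  move=> xpi; apply: (@liouville_zero R (fun l => s x l * ct x l - c x l * st x l)).
    exact: entireB (entireM (es x xpi) (ect x xpi)) (entireM (ec x xpi) (est x xpi)).
  move=> e e0.
  have [B HB] := cross_product_decay xpi hpsi hpsit sL2 stL2 HL HLt hM hp1 hp2 Hc Hs Hct Hst.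
  pose t := Num.max 1 (B / e); have t1 : 1 <= t by rewrite le_max lexx.
  exists (t ^+ 2) => l.
  have [m -> m0] := half_plane_sqrt l.
  rewrite cnN cnX ler_pXn2r ?nnegrE ?cn_ge0 ?(le_trans ler01) // => tm.
  have m1 : 1 <= cn m by exact: le_trans tm.
  have cm : 0 < cn m by rewrite (lt_le_trans ltr01).
  rewrite -(ler_pM2l cm); apply: (le_trans (HB m m1 m0)).
  by rewrite -ler_pdivrMr // (le_trans _ tm) // le_max lexx orbT.
have [Sc c0 cq0] := Hc 0; have [Ss s0 sq0] := Hs 0.
have [Sct ct0 ctq0] := Hct 0; have [Sst st0 stq0] := Hst 0.
have E := potential_unique Sc c0 cq0 Ss s0 sq0 Sct ct0 ctq0 Sst st0 stq0 D0.
split=> //; apply: normalized_coprime_unique => //.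
apply/eqP; rewrite -subr_eq0; apply/eqP.
apply: (@poly_eq0_large R _ (Num.max K Kt)) => m; rewrite ge_max => /andP[Km Ktm].
set l := - m ^+ 2.
have [/is_solution_solves Sp ypi vpi] := hpsi l.
have [/is_solution_solves [pt ptq] ytpi vtpi] := hpsit l.
have Spt : solves (sigma L) l (psit ^~ l) (psitq ^~ l).
  by split; [apply: ac_cprim_eq pt|apply: ac_cprim_eq ptq]; apply: ae_0pi_mp E => x _ ->.
have pipi : 0 <= (pi : R) <= pi by rewrite lexx pi_ge0.
have := wronskian_const Sp Spt pipi.
have := weyl_cross HL HLt hM hp1 hp2 Km Ktm; rewrite -/l /= => ->.
rewrite ypi vpi ytpi vtpi hornerD hornerN !hornerM [psit 0 l * _]mulrC subrr => W.
by apply: oppr_inj; rewrite oppr0 -[RHS]W; ring.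
Qed.
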